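(* Let $k\ge 1$ be an integer and $\theta = 2\pi/(4k+2)$. Let $P$ be a finite set of points in general position and $S$ a set of constraints on $P$. Let $u,w\in P$ be two vertices such that $u$ can see $w$, let $m$ be the midpoint of the side of the canonical triangle $T_{uw}$ opposite $u$, and let $\alpha$ be the unsigned angle between the segments $uw$ and $um$. Then there exists a path connecting $u$ and $w$ in the constrained $\theta_{(4k+2)}$-graph of $P$ with respect to $S$ of length at most \[\left( \frac{1 + \sin \left(\frac{\theta}{2}\right)}{\cos \left(\frac{\theta}{2}\right)} \cdot \cos \alpha + \sin \alpha \right) \cdot |u w|.\]
   Context: $P$ is a finite set of points in the plane and $S$ is a set of line segments (called constraints), each joining two points of $P$, such that no two constraints intersect properly. Two points $u,v\in P$ can see each other if and only if the segment $uv$ does not properly intersect any constraint or $uv$ is itself a constraint. Fix an integer $k\ge 1$, $x\in\{2,3,4,5\}$ and $\theta=2\pi/(4k+x)$. Around each point $u$, the $4k+x$ rays from $u$ with angle $\theta$ between consecutive rays define cones (regions between consecutive rays with apex $u$); they are oriented so that the bisector of one cone, $C_0^u$, is the vertical half-line above $u$, and the cones are numbered $C_0^u, C_1^u, \dots$ clockwise; all points use the same orientation. For every constraint $uv$ with $v\in C_i^u$, the line through that constraint splits $C_i^u$; the resulting pieces are the subcones of $C_i^u$ (if a constraint $uv$ splits a cone of $u$ into two subcones, $v$ is considered to lie in both; a cone not split is a single subcone). The constrained $\theta_{(4k+x)}$-graph has vertex set $P$ and, for each vertex $u$ and each subcone of each cone $C_i^u$, an edge between $u$ and the vertex $v$ of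 that subcone that can see $u$ and whose orthogonal projection onto the bisector of the full cone $C_i^u$ (not of the subcone) is closest to $u$ among all vertices of that subcone that can see $u$. Edges are weighted by Euclidean length, and the length of a path is the sum of its edge lengths. General position: no two points lie on a line parallel to one of the rays defining the cones, no two points lie on a line perpendicular to the bisector of a cone, and no three points are collinear. For a vertex $w$ in cone $C_i^u$, the canonical triangle $T_{uw}$ is the triangle bounded by the two boundary rays of $C_i^u$ and the line through $w$ perpendicular to the bisector of $C_i^u$. *)

(* Defs.v *)
From Stdlib Require Import Reals List.
Import ListNotations.
Open Scope R_scope.

Definition pt := (R * R)%type.
Definition vsub (p q : pt) : pt := (fst p - fst q, snd p - snd q).
Definition dot (a b : pt) : R := fst a * fst b + snd a * snd b.
Definition cross (a b : pt) : R := fst a * snd b - snd a * fst b.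
Definition norm (a : pt) : R := sqrt (dot a a).
Definition pdist (p q : pt) : R := norm (vsub p q).

Definition unsigned_angle (a b : pt) : R := acos (dot a b / (norm a * norm b)).

(** Cones: n cones of aperture theta = 2 pi / n around each point.  The
    bisector of cone C_i is obtained by rotating the upward vertical
    direction clockwise by i*theta. *)
Definition cone_angle (n : nat) : R := 2 * PI / INR n.

Definition bisector (n i : nat) : pt :=
  (sin (INR i * cone_angle n), cos (INR i * cone_angle n)).

(** The j-th ray (j < n) defining the cones: direction at clockwise angle
    (2j+1)*theta/2 from the upward vertical. *)
Definition ray_dir (n j : nat) : pt :=
  let a := (2 * INR j + 1) * cone_angle n / 2 in (sin a, cos a).

(** v lies in the (open) cone C_i^u: the angle between uv and the bisector
    is less than theta/2. *)
Definition in_cone (n : nat) (u : pt) (i : nat) (v : pt) : Prop :=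
  (i < n)%nat /\
  dot (vsub v u) (bisector n i) > norm (vsub v u) * cos (cone_angle n / 2).

Definition proj (n i : nat) (u v : pt) : R := dot (vsub v u) (bisector n i).

Definition is_constraint (S : list (pt * pt)) (a b : pt) : Prop :=
  In (a, b) S \/ In (b, a) S.

Definition properly_intersect (a b c d : pt) : Prop :=
  cross (vsub b a) (vsub c a) * cross (vsub b a) (vsub d a) < 0 /\
  cross (vsub d c) (vsub a c) * cross (vsub d c) (vsub b c) < 0.

Definition sees (S : list (pt * pt)) (a b : pt) : Prop :=
  is_constraint S a b \/
  (forall c d, In (c, d) S -> ~ properly_intersect a b c d).

Definition constraints_ok (P : list pt) (S : list (pt * pt)) : Prop :=
  (forall a b, In (a, b) S -> In a P /\ In b P /\ a <> b) /\
  (forall a b c d, In (a, b) S -> In (c, d) S -> ~ properly_intersect a b c d).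

Definition general_position (n : nat) (P : list pt) : Prop :=
  forall p q, In p P -> In q P -> p <> q ->
    (forall j, (j < n)%nat -> cross (vsub q p) (ray_dir n j) <> 0) /\
    (forall i, (i < n)%nat -> dot (vsub q p) (bisector n i) <> 0) /\
    (forall r, In r P -> r <> p -> r <> q -> cross (vsub q p) (vsub r p) <> 0).

(** Direction uc lies strictly (angularly) between ux and uy; meaningful for
    directions within a single cone (aperture < pi). *)
Definition strictly_between (u x c y : pt) : Prop :=
  cross (vsub x u) (vsub c u) * cross (vsub c u) (vsub y u) > 0.

(** w lies in the subcone of C_i^u that contains v; when uv is itself a
    constraint, v lies in two subcones and the sign s (= 1 or -1) selects
    the side of line uv. *)
Definition in_subcone (n : nat) (P : list pt) (S : list (pt * pt))
    (u : pt) (i : nat) (v : pt) (s : R) (w : pt) : Prop :=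
  in_cone n u i w /\
  (forall c, In c P -> is_constraint S u c -> in_cone n u i c ->
     ~ strictly_between u v c w) /\
  (is_constraint S u v -> 0 <= s * cross (vsub v u) (vsub w u)).

Definition chosen (n : nat) (P : list pt) (S : list (pt * pt)) (u v : pt) : Prop :=
  In u P /\ In v P /\
  exists i s, (s = 1 \/ s = -1) /\ in_cone n u i v /\ sees S u v /\
    forall w, In w P -> in_subcone n P S u i v s w -> sees S u w ->
      proj n i u v <= proj n i u w.

Definition theta_edge (n : nat) (P : list pt) (S : list (pt * pt)) (a b : pt) : Prop :=
  chosen n P S a b \/ chosen n P S b a.

Fixpoint chain (E : pt -> pt -> Prop) (l : list pt) : Prop :=
  match l with
  | x :: ((y :: _) as t) => E x y /\ chain E t
  | _ => True
  end.

Fixpoint path_length (l : list pt) : R :=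
  match l with
  | x :: ((y :: _) as t) => pdist x y + path_length t
  | _ => 0
  end.

Definition graph_path (n : nat) (P : list pt) (S : list (pt * pt)) (u w : pt)
    (l : list pt) : Prop :=
  hd_error l = Some u /\ last l u = w /\ chain (theta_edge n P S) l.

(** Corners of the canonical triangle T_uw (w in C_i^u) on the side opposite
    u: intersections of the boundary rays of C_i^u (sg = 1 / sg = -1) with
    the line through w perpendicular to the bisector. *)
Definition canon_corner (n : nat) (u : pt) (i : nat) (w : pt) (sg : R) : pt :=
  let th := cone_angle n in
  let a := INR i * th + sg * (th / 2) in
  let t := proj n i u w / cos (th / 2) in
  (fst u + t * sin a, snd u + t * cos a).

Definition canon_midpoint (n : nat) (u : pt) (i : nat) (w : pt) : pt :=
  let c1 := canon_corner n u i w 1 in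
  let c2 := canon_corner n u i w (-1) in
  ((fst c1 + fst c2) / 2, (snd c1 + snd c2) / 2).

(* Main.v *)
Require Import Defs.
From Stdlib Require Import Reals List Lra Lia Psatz ZArith Classical.
Open Scope R_scope.

(** Induct on the height [h] of [w] over [u] along the bisector [b] of the cone.
    With lateral offset [x] and [K = (1 + sin (th/2)) / cos (th/2)], going round the
    two upper corners of the canonical triangle costs [K h + x] and [K h - x].  The
    stronger claim proved is that the distance in the graph is at most [K h + |x|],
    and at most [K h + x] when the part of the triangle right of [uw] contains no
    vertex (up to mirror image, encoded by a sign [sg]).
    Let [v] be the neighbour of [u] in the subcone of [w], say left of [uw].  From
    [v] follow the convex chain of visibility edges bounding the empty region next to
    [u], found one tangent at a time, up to [w].  Each chain edge [pq] has height [dh]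
    over [p] and offset [dx] with respect to [b], and lies in the [j]-th cone of [p]
    to the right of [b], [j <= k].  If [0 < j < k], the bound for that cone is at most
    [K dh + dx], by comparing two values of one cosine; if [j = k], the triangle with apex [q] is
    empty on the side of [u], and the bound for it is exactly [K dh + dx]; if [j = 0],
    it is [K dh + |dx|], or [K dh + dx] when the right part of the large triangle is
    empty.  These sums telescope; once [dx] is negative it stays so along the chain,
    which lies left of [u] from there on, and so the total is at most [K h + |x|]. *)

(** * Finite minima and paths *)

Lemma argmin_exists {A : Type} (f : A -> R) (Q : A -> Prop) (l : list A) :
  (exists x, In x l /\ Q x) ->
  exists x, In x l /\ Q x /\ forall y, In y l -> Q y -> f x <= f y.
Proof.
  induction l as [|a l IH]; intros [x [Hx Qx]]; [destruct Hx|].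
  destruct (classic (exists y, In y l /\ Q y)) as [E|E].
  - destruct (IH E) as [m [Hm [Qm Lm]]].
    destruct (classic (Q a /\ f a < f m)) as [[Qa La]|N].
    + exists a; split; [now left|split; [exact Qa|]].
      intros y [<-|Hy] Qy; [lra|]. specialize (Lm y Hy Qy); lra.
    + exists m; split; [now right|split; [exact Qm|]].
      intros y [<-|Hy] Qy; [|now apply Lm].
      apply Rnot_lt_le; intro; apply N; now split.
  - assert (x = a) as -> by (destruct Hx as [->|Hx]; [easy|exfalso; apply E; now exists x]).
    exists a; split; [now left|split; [exact Qx|]].
    intros y [<-|Hy] Qy; [lra|]. exfalso; apply E; now exists y.
Qed.

(** The order of the reals is not well founded, but a finite list has a counterexample of least
    measure. This serves both the outer induction on heights and the induction along the chain. *)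
Lemma finite_real_induction {A : Type} (f : A -> R) (Q : A -> Prop) (l : list A) :
  (forall x, In x l -> (forall y, In y l -> f y < f x -> Q y) -> Q x) ->
  forall x, In x l -> Q x.
Proof.
  intros Hstep x Hx. apply NNPP; intro N.
  destruct (argmin_exists f (fun y => ~ Q y) l) as [m [Hm [Nm Lm]]]; [now exists x|].
  apply Nm, Hstep; [exact Hm|]. intros y Hy Hlt. apply NNPP; intro Ny.
  specialize (Lm y Hy Ny); lra.
Qed.

(** The real index is an upper bound, with slack in both constructors, so that estimates can be
    added and weakened without naming vertex lists. *)
Inductive linked (E : pt -> pt -> Prop) : pt -> pt -> R -> Prop :=
| linked_refl a L : 0 <= L -> linked E a a L
| linked_step a b c L L' : E a b -> linked E b c L -> pdist a b + L <= L' -> linked E a c L'.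

Lemma linked_le E a b L L' : linked E a b L -> L <= L' -> linked E a b L'.
Proof.
  intros H; revert L'; induction H as [a L H|a b c L L' Hab Hbc IH HL]; intros L2 H2.
  - apply linked_refl; lra.
  - eapply linked_step; eauto; lra.
Qed.

Lemma linked_edge (E : pt -> pt -> Prop) a b L : E a b -> pdist a b <= L -> linked E a b L.
Proof.
  intros H HL. apply linked_step with b 0; auto; [apply linked_refl|]; lra.
Qed.

Lemma linked_trans E a b c L1 L2 :
  linked E a b L1 -> linked E b c L2 -> linked E a c (L1 + L2).
Proof.
  induction 1 as [a L H|a b d L L' Hab Hbd IH HL]; intros Hc.
  - apply linked_le with L2; auto; lra.
  - apply linked_step with b (L + L2); auto; lra.
Qed.

Lemma pdist_sym a b : pdist a b = pdist b a.
Proof. unfold pdist, norm, dot, vsub; simpl; f_equal; ring. Qed.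

Lemma linked_sym (E : pt -> pt -> Prop) a b L :
  (forall x y, E x y -> E y x) -> linked E a b L -> linked E b a L.
Proof.
  intros HE. induction 1 as [a L H|a b d L L' Hab Hbd IH HL].
  - now apply linked_refl.
  - apply linked_le with (L + pdist a b); [|lra].
    apply linked_trans with b; auto.
    apply linked_edge; auto. rewrite pdist_sym; lra.
Qed.

Lemma linked_path (E : pt -> pt -> Prop) a b L : linked E a b L ->
  exists l, hd_error l = Some a /\ (forall x, last l x = b) /\ chain E l /\ path_length l <= L.
Proof.
  induction 1 as [a L H|a b c L L' Hab Hbc IH HL].
  - exists (a :: nil); simpl; auto.
  - destruct IH as [[|x l] [Hh [Hl [Hc Hp]]]]; [discriminate|].
    injection Hh as ->. exists (a :: b :: l); split; [easy|split].
    + intro x; apply (Hl x).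
    + split; [now split|]. change (pdist a b + path_length (b :: l) <= L'). lra.
Qed.

(** * Coordinates in a cone frame *)

Definition perp (b : pt) : pt := (snd b, - fst b).
(* Offset along the normal to [b]; [sg = -1] mirrors the plane, so that "left" and "right"
   below are relative to [sg]. *)
Definition lat (sg : R) (b v : pt) : R := sg * dot v (perp b).
Definition turn (sg : R) (v w : pt) : R := sg * cross v w.
Definition lerp (t : R) (x y : pt) : pt :=
  ((1 - t) * fst x + t * fst y, (1 - t) * snd x + t * snd y).
(** Half-planes are given by such functions. The visibility lemmas take one as a parameter since
    they are used with the line of a chain edge and with a line perpendicular to [b]. *)
Definition affine (f : pt -> R) : Prop :=
  forall t x y, f (lerp t x y) = (1 - t) * f x + t * f y.

Lemma turn_coords sg b v w : sg * sg = 1 -> dot b b = 1 ->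
  turn sg v w = lat sg b v * dot w b - dot v b * lat sg b w.
Proof.
  unfold turn, lat, dot, cross, perp; simpl; intros Hs Hb.
  replace (sg * (fst v * snd w - snd v * fst w)) with
    (sg * (fst v * snd w - snd v * fst w) * (fst b * fst b + snd b * snd b)) by (rewrite Hb; ring).
  ring.
Qed.

Lemma norm_coords sg b v : sg * sg = 1 -> dot b b = 1 ->
  norm v = sqrt (lat sg b v * lat sg b v + dot v b * dot v b).
Proof.
  intros Hs Hb. unfold norm; f_equal. unfold lat.
  replace (sg * dot v (perp b) * (sg * dot v (perp b)))
    with ((sg * sg) * (dot v (perp b) * dot v (perp b))) by ring.
  rewrite Hs, Rmult_1_l, <- (Rmult_1_r (dot v v)), <- Hb.
  unfold dot, perp; simpl; ring.
Qed.

(** With [r] the root, [(x c)^2 - (h s)^2 = (r c)^2 - h^2]. Squaring thus turns membership in a cone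
    into two linear inequalities, the form used from here on. *)
Lemma sector_iff x h s c : 0 < s -> 0 < c -> s * s + c * c = 1 ->
  sqrt (x * x + h * h) * c < h <-> - (h * s) < x * c < h * s.
Proof.
  intros Hs Hc Hsc.
  assert (Hq : 0 <= x * x + h * h) by nra.
  pose proof (sqrt_pos (x * x + h * h)) as Hp.
  pose proof (sqrt_sqrt _ Hq) as Hr.
  set (r := sqrt (x * x + h * h)) in *. clearbody r.
  assert (Hx : (x * c) * (x * c) - (h * s) * (h * s) = (r * c) * (r * c) - h * h).
  { replace ((r * c) * (r * c)) with (r * r * (c * c)) by ring. rewrite Hr.
    replace (s * s) with (1 - c * c) by lra.
    replace (h * s * (h * s)) with (h * h * (s * s)) by ring.
    replace (s * s) with (1 - c * c) by lra. ring. }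
  split.
  - intro H. assert (0 <= r * c) by nra.
    assert (0 < h * s) by nra. split; nra.
  - intros [H1 H2]. assert (0 < h * s) by lra. assert (0 < h) by nra.
    assert (0 <= r * c) by nra. nra.
Qed.

(** * Affine functions and crossing segments *)

Lemma affine_turn sg v u : affine (fun x => turn sg v (vsub x u)).
Proof. intros t x y; unfold turn, cross, vsub, lerp; simpl; ring. Qed.

Lemma affine_dot b u e : affine (fun x => dot (vsub x u) b - e).
Proof. intros t x y; unfold dot, vsub, lerp; simpl; ring. Qed.

Lemma properly_intersect_lerp a b c d : properly_intersect a b c d ->
  exists s t, 0 < s < 1 /\ 0 < t < 1 /\ lerp s a b = lerp t c d.
Proof.
  intros [H1 H2].
  set (x := cross (vsub b a) (vsub c a)) in *. set (y := cross (vsub b a) (vsub d a)) in *.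
  set (z := cross (vsub d c) (vsub a c)) in *. set (e := cross (vsub d c) (vsub b c)) in *.
  assert (N1 : x - y <> 0) by (intro; assert (x = y) by lra; nra).
  assert (N2 : z - e <> 0) by (intro; assert (z = e) by lra; nra).
  assert (F : forall a b, a * b < 0 -> a - b <> 0 -> 0 < a / (a - b) < 1).
  { clear. intros a b H N.
    assert (E : a / (a - b) = (a * (a - b)) / ((a - b) * (a - b))) by (field; lra).
    rewrite E. assert (0 < (a - b) * (a - b)) by nra. split.
    - apply Rdiv_lt_0_compat; nra.
    - apply Rmult_lt_reg_r with ((a - b) * (a - b)); [easy|].
      unfold Rdiv; rewrite Rmult_assoc, Rinv_l by lra. nra. }
  (* An affine function with values [z] and [e] of opposite signs at the two ends vanishes at the
     parameter [z / (z - e)]. *)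
  exists (z / (z - e)), (x / (x - y)).
  split; [now apply F|]. split; [now apply F|].
  assert (EQ : x - y = - (z - e)) by (unfold x, y, z, e, cross, vsub; simpl; ring).
  unfold lerp; f_equal.
  - apply Rmult_eq_reg_r with ((x - y) * (z - e)); [|now apply Rmult_integral_contrapositive].
    field_simplify; [|easy|easy].
    unfold x, y, z, e, cross, vsub; simpl; ring.
  - apply Rmult_eq_reg_r with ((x - y) * (z - e)); [|now apply Rmult_integral_contrapositive].
    field_simplify; [|easy|easy].
    unfold x, y, z, e, cross, vsub; simpl; ring.
Qed.

Lemma lerp_properly_intersect a b c d s t : 0 < s < 1 -> 0 < t < 1 ->
  lerp s a b = lerp t c d -> cross (vsub b a) (vsub d c) <> 0 -> properly_intersect a b c d.
Proof.
  unfold lerp; intros Hs Ht H N. injection H as Hx Hy.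
  set (k := cross (vsub b a) (vsub d c)) in *.
  (* All four cross products are multiples of [k], with factors [-t], [1 - t], [s], [-(1 - s)]. Each
     computation adds the common point written in one way and subtracts it written in the other. *)
  assert (E1 : cross (vsub b a) (vsub c a) = - t * k).
  { transitivity (cross (vsub b a) (fst c - ((1 - t) * fst c + t * fst d) + ((1 - s) * fst a + s * fst b) - fst a,
       snd c - ((1 - t) * snd c + t * snd d) + ((1 - s) * snd a + s * snd b) - snd a)).
    - unfold vsub; simpl; rewrite Hx, Hy; unfold cross; simpl; ring.
    - unfold k, cross, vsub; simpl; ring. }
  assert (E2 : cross (vsub b a) (vsub d a) = (1 - t) * k).
  { transitivity (cross (vsub b a) (vsub c a) + k); [unfold k, cross, vsub; simpl; ring|].
    rewrite E1; ring. }
  assert (E3 : cross (vsub d c) (vsub a c) = s * k).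
  { transitivity (cross (vsub d c) (fst a - ((1 - s) * fst a + s * fst b) + ((1 - t) * fst c + t * fst d) - fst c,
       snd a - ((1 - s) * snd a + s * snd b) + ((1 - t) * snd c + t * snd d) - snd c)).
    - unfold vsub; simpl; rewrite Hx, Hy; unfold cross; simpl; ring.
    - unfold k, cross, vsub; simpl; ring. }
  assert (E4 : cross (vsub d c) (vsub b c) = - (1 - s) * k).
  { transitivity (cross (vsub d c) (vsub a c) - k); [unfold k, cross, vsub; simpl; ring|].
    rewrite E3; ring. }
  assert (0 < k * k) by nra.
  unfold properly_intersect; rewrite E1, E2, E3, E4. split.
  - assert (0 < t * (1 - t)) by nra. nra.
  - assert (0 < s * (1 - s)) by nra. nra.
Qed.

(** * Visibility inside a wedge *)

(** Under [constraints_ok] a constraint is itself uncrossed, so this follows from [sees]; it also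
    implies [sees]. Visibility is handled in this form, without the case of a constraint. *)
Definition uncrossed (S : list (pt * pt)) (a b : pt) : Prop :=
  forall c d, In (c, d) S -> ~ properly_intersect a b c d.

Definition noncollinear (P : list pt) : Prop := forall p q r, In p P -> In q P -> In r P ->
  p <> q -> r <> p -> r <> q -> cross (vsub q p) (vsub r p) <> 0.

Lemma properly_intersect_sym_l a b c d : properly_intersect a b c d -> properly_intersect b a c d.
Proof.
  unfold properly_intersect, cross, vsub; simpl. intros [H1 H2]; split; [|lra].
  replace (_ * _) with (((fst b - fst a) * (snd c - snd a) - (snd b - snd a) * (fst c - fst a)) *
     ((fst b - fst a) * (snd d - snd a) - (snd b - snd a) * (fst d - fst a))) by ring. easy.
Qed.

Lemma properly_intersect_sym_r a b c d : properly_intersect a b c d -> properly_intersect a b d c.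
Proof.
  unfold properly_intersect, cross, vsub; simpl. intros [H1 H2]; split; [lra|].
  replace (_ * _) with (((fst d - fst c) * (snd a - snd c) - (snd d - snd c) * (fst a - fst c)) *
     ((fst d - fst c) * (snd b - snd c) - (snd d - snd c) * (fst b - fst c))) by ring. easy.
Qed.

Lemma sees_uncrossed P S a b : constraints_ok P S -> sees S a b -> uncrossed S a b.
Proof.
  intros [_ H2] [[H|H]|H] c d Hc; [now apply H2| |now apply H].
  intro N. apply (H2 b a c d H Hc), properly_intersect_sym_l, N.
Qed.

Lemma uncrossed_sym S a b : uncrossed S a b -> uncrossed S b a.
Proof. intros H c d Hc N. now apply (H c d Hc), properly_intersect_sym_l. Qed.

Lemma sign_sq sg : sg = 1 \/ sg = -1 -> sg * sg = 1.
Proof. intros [->| ->]; ring. Qed.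

Lemma lerp_lerp s t a b : lerp s (lerp t a b) a = lerp (t * (1 - s)) a b.
Proof. unfold lerp; simpl; f_equal; ring. Qed.

Lemma lerp_flip t a b : lerp t a b = lerp (1 - t) b a.
Proof. unfold lerp; simpl; f_equal; ring. Qed.

(* The segment from [z], inside the wedge at [u] spanned by [p] and [w], leaves it first
   through the ray [up]; as [f] stays negative, it does so before reaching [p]. *)
Lemma exit_side sg u p w z c f :
  sg * sg = 1 -> affine f -> f u < 0 -> 0 <= f p -> f z <= 0 -> f c < 0 ->
  0 < turn sg (vsub w u) (vsub p u) ->
  turn sg (vsub p u) (vsub z u) < 0 -> 0 < turn sg (vsub p u) (vsub c u) ->
  turn sg (vsub p u) (vsub z u) * turn sg (vsub w u) (vsub c u)
    < turn sg (vsub p u) (vsub c u) * turn sg (vsub w u) (vsub z u) ->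
  exists s t, 0 < s < 1 /\ 0 < t < 1 /\ lerp t u p = lerp s z c.
Proof.
  intros Hsg Hf Hu Hp Hz Hc Hwp H1z H1c Hlt.
  set (z1 := turn sg (vsub p u) (vsub z u)) in *.
  set (c1 := turn sg (vsub p u) (vsub c u)) in *.
  set (z2 := turn sg (vsub w u) (vsub z u)) in *.
  set (c2 := turn sg (vsub w u) (vsub c u)) in *.
  set (D := turn sg (vsub w u) (vsub p u)) in *.
  assert (HD : 0 < c1 - z1) by lra.
  (* The parameter at which [zc] meets the line [up]; the meeting point is [y]. *)
  pose (s := - z1 / (c1 - z1)).
  assert (Es : s * (c1 - z1) = - z1) by (unfold s; field; lra).
  assert (Hs : 0 < s < 1) by (split; nra).
  pose (y := lerp s z c).
  assert (Y1 : turn sg (vsub p u) (vsub y u) = 0).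
  { unfold y. rewrite (affine_turn sg (vsub p u) u s z c). fold z1 c1. lra. }
  assert (Y2 : turn sg (vsub w u) (vsub y u) = (1 - s) * z2 + s * c2).
  { unfold y. now rewrite (affine_turn sg (vsub w u) u s z c). }
  set (y2 := turn sg (vsub w u) (vsub y u)) in *.
  (* A positive value puts [y] on the same side of [u] as [p]. The last hypothesis says just this,
     after multiplication by [c1 - z1]. *)
  assert (Y2p : 0 < y2).
  { assert (y2 * (c1 - z1) = c1 * z2 - z1 * c2).
    { rewrite Y2. replace (((1 - s) * z2 + s * c2) * (c1 - z1))
        with (z2 * (c1 - z1) + (c2 - z2) * (s * (c1 - z1))) by ring. rewrite Es; ring. }
    apply Rmult_lt_reg_r with (c1 - z1); lra. }
  assert (Fy : f y < 0) by (unfold y; rewrite Hf; nra).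
  pose (t := y2 / D).
  assert (Et : t * D = y2) by (unfold t; field; lra).
  assert (Ht : 0 < t) by (apply Rdiv_lt_0_compat; lra).
  assert (Ey : lerp t u p = y).
  { assert (Hd : forall x : R, D * x = 0 -> x = 0)
      by (intros x Hx; apply Rmult_eq_reg_l with D; lra).
    assert (G : forall g : pt -> R, (forall x y, g x - g y = g (vsub x y)) ->
       D * g (vsub y u) = y2 * g (vsub p u) -> g (lerp t u p) = (1-t) * g u + t * g p ->
       g (lerp t u p) = g y).
    { intros g Hg HE HL. apply Rminus_diag_uniq, Hd. rewrite HL.
      replace (D * ((1 - t) * g u + t * g p - g y)) with
        ((t * D) * (g p - g u) - D * (g y - g u)) by ring.
      rewrite Et, !Hg, HE; ring. }
    clearbody y.
    rewrite (surjective_pairing (lerp t u p)), (surjective_pairing y). f_equal.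
    - apply (G fst); [reflexivity| |reflexivity].
      unfold D, y2, turn, cross in *. 
      replace (sg * (fst (vsub w u) * snd (vsub y u) - snd (vsub w u) * fst (vsub y u)) * fst (vsub p u))
        with (sg * (fst (vsub w u) * snd (vsub p u) - snd (vsub w u) * fst (vsub p u)) * fst (vsub y u)
           + fst (vsub w u) * (sg * (fst (vsub p u) * snd (vsub y u) - snd (vsub p u) * fst (vsub y u)))) by ring.
      rewrite Y1; ring.
    - apply (G snd); [reflexivity| |reflexivity].
      unfold D, y2, turn, cross in *. 
      replace (sg * (fst (vsub w u) * snd (vsub y u) - snd (vsub w u) * fst (vsub y u)) * snd (vsub p u))
        with (sg * (fst (vsub w u) * snd (vsub p u) - snd (vsub w u) * fst (vsub p u)) * snd (vsub y u)
           + snd (vsub w u) * (sg * (fst (vsub p u) * snd (vsub y u) - snd (vsub p u) * fst (vsub y u)))) by ring.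
      rewrite Y1; ring. }
  exists s, t. split; [easy|]. split; [|now rewrite Ey].
  split; [easy|]. rewrite <- Ey, Hf in Fy. nra.
Qed.

Lemma turn_neg sg v w : turn (- sg) v w = - turn sg v w.
Proof. unfold turn; ring. Qed.
Lemma turn_anti sg v w : turn sg v w = - turn sg w v.
Proof. unfold turn, cross; ring. Qed.

Lemma parallel_zero sg a w v : turn sg w a <> 0 -> turn sg a v = 0 -> turn sg w v = 0 ->
  v = (0, 0).
Proof.
  intros N H1 H2.
  assert (E1 : turn sg w a * fst v = turn sg w v * fst a + turn sg v a * fst w)
    by (unfold turn, cross; ring).
  assert (E2 : turn sg w a * snd v = turn sg w v * snd a + turn sg v a * snd w)
    by (unfold turn, cross; ring).
  rewrite (turn_anti sg v a), H1, H2 in E1, E2.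
  destruct v as [x y]; simpl in *. f_equal; apply Rmult_eq_reg_l with (turn sg w a); auto; lra.
Qed.

(** The two products compared are the terms of a determinant whose sign tells on which side of the
    line [zc] the apex [u] lies. Accordingly the segment leaves through [up], through [u], or
    through [uw]; the last case mirrors the first, with [p] and [w] exchanged. *)
Lemma wedge_exit sg u p w z c f :
  sg * sg = 1 -> affine f -> f u < 0 -> 0 <= f p -> 0 <= f w -> f z <= 0 -> f c < 0 ->
  0 < turn sg (vsub w u) (vsub p u) ->
  turn sg (vsub p u) (vsub z u) < 0 -> 0 < turn sg (vsub w u) (vsub z u) ->
  0 < turn sg (vsub p u) (vsub c u) \/ turn sg (vsub w u) (vsub c u) < 0 ->
  (exists s t, 0 < s < 1 /\ 0 < t < 1 /\ lerp t u p = lerp s z c) \/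
  (exists s t, 0 < s < 1 /\ 0 < t < 1 /\ lerp t u w = lerp s z c) \/
  (exists s, 0 < s < 1 /\ lerp s z c = u).
Proof.
  intros Hsg Hf Hu Hp Hw Hz Hc Hwp H1z H2z Hout.
  destruct (total_order_T
     (turn sg (vsub p u) (vsub z u) * turn sg (vsub w u) (vsub c u))
     (turn sg (vsub p u) (vsub c u) * turn sg (vsub w u) (vsub z u))) as [[L|E]|G].
  - left. apply exit_side with sg w f; auto.
    destruct Hout as [?|H]; [easy|].
    set (z1 := turn sg (vsub p u) (vsub z u)) in *.
    set (c1 := turn sg (vsub p u) (vsub c u)) in *.
    set (z2 := turn sg (vsub w u) (vsub z u)) in *.
    set (c2 := turn sg (vsub w u) (vsub c u)) in *. nra.
  - right; right.
    set (z1 := turn sg (vsub p u) (vsub z u)) in *.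
    set (c1 := turn sg (vsub p u) (vsub c u)) in *.
    set (z2 := turn sg (vsub w u) (vsub z u)) in *.
    set (c2 := turn sg (vsub w u) (vsub c u)) in *.
    assert (0 < c1) by (destruct Hout; [easy|nra]).
    exists (- z1 / (c1 - z1)).
    set (s := - z1 / (c1 - z1)).
    assert (Es : s * (c1 - z1) = - z1) by (unfold s; field; lra).
    split; [split; nra|].
    assert (V : vsub (lerp s z c) u = (0, 0)).
    { apply parallel_zero with sg (vsub p u) (vsub w u); [lra| |].
      - rewrite (affine_turn sg (vsub p u) u s z c). fold z1 c1. lra.
      - rewrite (affine_turn sg (vsub w u) u s z c). fold z2 c2.
        apply Rmult_eq_reg_r with (c1 - z1); [|lra].
        replace (((1 - s) * z2 + s * c2) * (c1 - z1))
          with (z2 * (c1 - z1) + (c2 - z2) * (s * (c1 - z1))) by ring. rewrite Es; lra. }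
    destruct u; unfold vsub in V; simpl in V. injection V as V1 V2.
    unfold lerp; f_equal; lra.
  - right; left. apply exit_side with (- sg) p f; auto; rewrite ?turn_neg; try lra.
    + rewrite turn_anti; lra.
    + destruct Hout as [H|?]; [|lra].
      set (z1 := turn sg (vsub p u) (vsub z u)) in *.
      set (c1 := turn sg (vsub p u) (vsub c u)) in *.
      set (z2 := turn sg (vsub w u) (vsub z u)) in *.
      set (c2 := turn sg (vsub w u) (vsub c u)) in *. nra.
Qed.

(** Suppose a constraint has a point in the part [f <= 0] of the wedge, and follow it to the end [c]
    with [f c < 0]. That end is outside the wedge, so on the way the constraint crosses [up] or
    [uw], against visibility, or passes through [u], against noncollinearity. Constraints ending at
    [u] are excluded by hypothesis. *)
Lemma wedge_constraint_free sg P S u p w f :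
  sg * sg = 1 -> constraints_ok P S -> noncollinear P -> In u P -> In p P -> In w P ->
  uncrossed S u p -> uncrossed S u w -> 0 < turn sg (vsub w u) (vsub p u) ->
  affine f -> f u < 0 -> 0 <= f p -> 0 <= f w ->
  (forall x, In x P -> turn sg (vsub p u) (vsub x u) < 0 ->
     0 < turn sg (vsub w u) (vsub x u) -> 0 <= f x) ->
  (forall x, is_constraint S u x -> turn sg (vsub p u) (vsub x u) < 0 ->
     turn sg (vsub w u) (vsub x u) <= 0) ->
  forall c d t, is_constraint S c d -> 0 < t < 1 -> f (lerp t c d) <= 0 -> f c < 0 ->
  turn sg (vsub p u) (vsub (lerp t c d) u) < 0 ->
  turn sg (vsub w u) (vsub (lerp t c d) u) <= 0.
Proof.
  intros Hsg [HS _] Hnc Pu Pp Pw Hup Huw Hwp Hf Fu Fp Fw Hempty Hcon c d t Hcd Ht Fz Fc H1z.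
  apply Rnot_lt_le; intro H2z.
  assert (Sc : In c P /\ In d P /\ c <> d).
  { destruct Hcd as [H|H]; apply HS in H; intuition. }
  destruct Sc as [Pc [Pd Ncd]].
  assert (T0 : forall v, turn sg v (vsub u u) = 0)
    by (intro; unfold turn, cross, vsub; simpl; ring).
  assert (A1 := affine_turn sg (vsub p u) u t c d).
  assert (A2 := affine_turn sg (vsub w u) u t c d). simpl in A1, A2.
  destruct (classic (c = u)) as [->|Ncu].
  { rewrite T0 in A1, A2. specialize (Hcon d Hcd). nra. }
  destruct (classic (d = u)) as [->|Ndu].
  { rewrite T0 in A1, A2. assert (is_constraint S u c) by (destruct Hcd; [right|left]; auto).
    specialize (Hcon c H). nra. }
  assert (Nz : forall v, In v P -> v <> u -> c <> v -> turn sg (vsub v u) (vsub c u) <> 0).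
  { intros v Pv Nv Ncv E. apply (Hnc u v c); auto. unfold turn in E. nra. }
  assert (Npu : p <> u) by (intros ->; rewrite T0 in Hwp; lra).
  assert (Nwu : w <> u) by (intros ->; rewrite turn_anti, T0 in Hwp; lra).
  assert (Ncp : c <> p) by (intros ->; lra).
  assert (Ncw : c <> w) by (intros ->; lra).
  assert (Hout : 0 < turn sg (vsub p u) (vsub c u) \/ turn sg (vsub w u) (vsub c u) < 0).
  { specialize (Nz p Pp Npu Ncp) as N1. specialize (Nz w Pw Nwu Ncw) as N2.
    destruct (Rtotal_order (turn sg (vsub p u) (vsub c u)) 0) as [L|[E|G]]; [|easy|now left].
    destruct (Rtotal_order (turn sg (vsub w u) (vsub c u)) 0) as [L'|[E|G]]; [now right|easy|].
    specialize (Hempty c Pc L G). lra. }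
  assert (Cross : forall v s r, In v P -> uncrossed S u v -> 
     turn sg (vsub v u) (vsub (lerp t c d) u) <> 0 -> 0 < s < 1 -> 0 < r < 1 ->
     lerp r u v = lerp s (lerp t c d) c -> False).
  { intros v s r Pv Hv Hn Hs Hr E. rewrite lerp_lerp in E.
    assert (Hp : properly_intersect u v c d).
    { apply lerp_properly_intersect with r (t * (1 - s)); auto; [split; nra|].
      intro Z.
      assert (V0 : turn sg (vsub v u) (vsub (lerp r u v) u) = 0)
        by (unfold turn, cross, vsub, lerp; simpl; ring).
      rewrite E in V0.
      rewrite (affine_turn sg (vsub v u) u (t * (1 - s)) c d) in V0.
      rewrite (affine_turn sg (vsub v u) u t c d) in Hn.
      assert (turn sg (vsub v u) (vsub d u) - turn sg (vsub v u) (vsub c u) = sg * cross (vsub v u) (vsub d c))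
        by (unfold turn, cross, vsub; simpl; ring).
      rewrite Z in H. assert (turn sg (vsub v u) (vsub d u) = turn sg (vsub v u) (vsub c u)) by lra.
      cbv beta in V0, Hn. rewrite H0 in V0, Hn. lra. }
    destruct Hcd as [H|H]; [exact (Hv c d H Hp)|].
    apply (Hv d c H), properly_intersect_sym_r, Hp. }
  destruct (wedge_exit sg u p w (lerp t c d) c f Hsg Hf Fu Fp Fw Fz Fc Hwp H1z H2z Hout)
    as [[s [r [Hs [Hr E]]]]|[[s [r [Hs [Hr E]]]]|[s [Hs E]]]].
  - apply (Cross p s r); auto; lra.
  - apply (Cross w s r); auto; lra.
  - rewrite lerp_lerp in E. apply (Hnc c d u); auto.
    rewrite <- E. unfold cross, vsub, lerp; simpl; ring.
Qed.

(** The common point of [ab] and a crossing constraint lies in the empty part of the wedge; an end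
    with [f < 0] gives the direction in which to follow that constraint. *)
Lemma wedge_uncrossed sg P S u p w f a b :
  sg * sg = 1 -> constraints_ok P S -> noncollinear P -> In u P -> In p P -> In w P ->
  uncrossed S u p -> uncrossed S u w -> 0 < turn sg (vsub w u) (vsub p u) ->
  affine f -> f u < 0 -> 0 <= f p -> 0 <= f w ->
  (forall x, In x P -> turn sg (vsub p u) (vsub x u) < 0 ->
     0 < turn sg (vsub w u) (vsub x u) -> 0 <= f x) ->
  (forall x, is_constraint S u x -> turn sg (vsub p u) (vsub x u) < 0 ->
     turn sg (vsub w u) (vsub x u) <= 0) ->
  (forall s, 0 < s < 1 -> turn sg (vsub p u) (vsub (lerp s a b) u) < 0 /\
     0 < turn sg (vsub w u) (vsub (lerp s a b) u) /\ f (lerp s a b) <= 0) ->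
  (forall c d, properly_intersect a b c d -> f c < 0 \/ f d < 0) ->
  uncrossed S a b.
Proof.
  intros Hsg HS Hnc Pu Pp Pw Hup Huw Hwp Hf Fu Fp Fw Hempty Hcon Hab Hlow c d Hcd Hx.
  destruct (properly_intersect_lerp _ _ _ _ Hx) as [s [t [Hs [Ht E]]]].
  destruct (Hab s Hs) as [H1 [H2 H3]].
  assert (G := wedge_constraint_free sg P S u p w f Hsg HS Hnc Pu Pp Pw Hup Huw Hwp Hf Fu Fp Fw Hempty Hcon).
  destruct (Hlow c d Hx) as [L|L].
  - assert (is_constraint S c d) by now left.
    rewrite E in H1, H2, H3. specialize (G c d t H Ht H3 L H1). lra.
  - assert (is_constraint S d c) by now right.
    rewrite (lerp_flip t c d) in E. rewrite E in H1, H2, H3.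
    assert (Ht' : 0 < 1 - t < 1) by lra.
    specialize (G d c (1 - t) H Ht' H3 L H1). lra.
Qed.

(** * Subcones *)

(** Unlike [in_cone], this takes a vector and a bisector, so that it applies to a cone however its
    direction is indexed. *)
Definition in_sector (n : nat) (b v : pt) : Prop := norm v * cos (cone_angle n / 2) < dot v b.

Lemma bisector_unit n i : dot (bisector n i) (bisector n i) = 1.
Proof.
  unfold dot, bisector; simpl.
  pose proof (sin2_cos2 (INR i * cone_angle n)) as H. unfold Rsqr in H. lra.
Qed.

(** The tangent of the clockwise angle from [b] to [v]. It makes betweenness inside a cone an order
    statement about reals, decided by linear arithmetic. *)
Definition slope (b v : pt) : R := lat 1 b v / dot v b.

Lemma cross_slope b v w : dot b b = 1 -> 0 < dot v b -> 0 < dot w b ->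
  cross v w = dot v b * dot w b * (slope b v - slope b w).
Proof.
  intros Hb Hv Hw. replace (cross v w) with (turn 1 v w) by (unfold turn; ring).
  rewrite (turn_coords 1 b v w) by lra. unfold slope. field. lra.
Qed.

Lemma mul_sign_pos a b x y : 0 < a -> 0 < b -> (a * x) * (b * y) > 0 <-> x * y > 0.
Proof.
  intros Ha Hb. assert (0 < a * b) by nra.
  replace (a * x * (b * y)) with (a * b * (x * y)) by ring. split; intro; nra.
Qed.

Lemma strictly_between_slope b u x c y : dot b b = 1 ->
  0 < dot (vsub x u) b -> 0 < dot (vsub c u) b -> 0 < dot (vsub y u) b ->
  strictly_between u x c y <->
    (slope b (vsub x u) < slope b (vsub c u) < slope b (vsub y u)) \/
    (slope b (vsub y u) < slope b (vsub c u) < slope b (vsub x u)).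
Proof.
  intros Hb Hx Hc Hy. unfold strictly_between.
  rewrite (cross_slope b (vsub x u) (vsub c u)), (cross_slope b (vsub c u) (vsub y u)) by easy.
  rewrite mul_sign_pos by now apply Rmult_lt_0_compat.
  set (r := slope b (vsub x u)). set (s := slope b (vsub c u)). set (t := slope b (vsub y u)).
  split.
  - intro H. assert (r - s <> 0) by (intro E; rewrite E in H; lra).
    destruct (Rlt_le_dec 0 (r - s)) as [L|L]; [right|left].
    + assert (0 < s - t) by (apply Rmult_lt_reg_l with (r - s); lra). lra.
    + assert (0 < t - s) by (apply Rmult_lt_reg_l with (s - r); lra). lra.
  - intros [[H1 H2]|[H1 H2]].
    + assert (0 < (s - r) * (t - s)) by (apply Rmult_lt_0_compat; lra). lra.
    + assert (0 < (r - s) * (s - t)) by (apply Rmult_lt_0_compat; lra). lra.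
Qed.

Lemma cone_dot_pos n u i v : (2 <= n)%nat -> in_cone n u i v -> 0 < dot (vsub v u) (bisector n i).
Proof.
  intros Hn [_ H]. assert (0 <= norm (vsub v u)) by apply sqrt_pos.
  assert (0 <= cos (cone_angle n / 2)); [|nra].
  assert (2 <= INR n) by (change 2 with (INR 2); now apply le_INR).
  pose proof PI_RGT_0.
  assert (Eq : cone_angle n / 2 * INR n = PI) by (unfold cone_angle; field; lra).
  apply cos_ge_0; nra.
Qed.

(** Take [v] lowest among the visible vertices of the subcone of [w]. As [chosen] describes subcones
    relative to the chosen vertex, the subcone seen from [v] has to be shown to lie in the one seen
    from [w]. *)
Lemma first_visible_in_subcone n P S u w i :
  (2 <= n)%nat -> noncollinear P -> In u P -> In w P -> sees S u w -> in_cone n u i w ->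
  exists v, In v P /\ in_cone n u i v /\ sees S u v /\ theta_edge n P S u v /\
   (v = w \/
    (proj n i u v <= proj n i u w /\
     (forall c, In c P -> is_constraint S u c -> in_cone n u i c -> ~ strictly_between u v c w) /\
     (forall r, In r P -> in_cone n u i r -> sees S u r -> strictly_between u v r w ->
        proj n i u v <= proj n i u r))).
Proof.
  intros Hn Hnc Pu Pw Hsee Hcone.
  set (b := bisector n i).
  assert (Hb : dot b b = 1) by apply bisector_unit.
  assert (Hpos : forall r, in_cone n u i r -> 0 < dot (vsub r u) b)
    by (intros r; now apply cone_dot_pos).
  assert (Hsb : forall x c y, in_cone n u i x -> in_cone n u i c -> in_cone n u i y ->
    strictly_between u x c y <->
    (slope b (vsub x u) < slope b (vsub c u) < slope b (vsub y u)) \/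
    (slope b (vsub y u) < slope b (vsub c u) < slope b (vsub x u))).
  { intros; apply strictly_between_slope; auto. }
  assert (Hcr : forall x y, in_cone n u i x -> in_cone n u i y -> exists m, 0 < m /\
     cross (vsub x u) (vsub y u) = m * (slope b (vsub x u) - slope b (vsub y u))).
  { intros x y Hx Hy. exists (dot (vsub x u) b * dot (vsub y u) b).
    split; [apply Rmult_lt_0_compat; auto|apply cross_slope; auto]. }
  assert (Nu : forall r, in_cone n u i r -> r <> u).
  { intros r Hr ->. apply Hpos in Hr. unfold dot, vsub in Hr; simpl in Hr. nra. }
  assert (Hne : forall x y, In x P -> In y P -> in_cone n u i x -> in_cone n u i y -> x <> y ->
     slope b (vsub x u) <> slope b (vsub y u)).
  { intros x y Px Py Hx Hy Nxy E. destruct (Hcr x y Hx Hy) as [m [Hm Em]].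
    apply (Hnc u x y); auto using not_eq_sym. rewrite Em, E; ring. }
  (* If [uw] is a constraint, [w] belongs to two subcones; the sign 1 fixes one of them. *)
  assert (Hww : in_subcone n P S u i w 1 w).
  { split; [easy|]. split.
    - intros c Pc Sc Cc Hs. apply Hsb in Hs; auto. lra.
    - intros _. unfold cross; lra. }
  destruct (argmin_exists (proj n i u)
    (fun r => sees S u r /\ in_subcone n P S u i w 1 r) P) as [v [Pv [[Sv Vv] Lv]]].
  { exists w; auto. }
  pose proof Vv as [Cv [Kv Sgv]].
  exists v. split; [easy|]. split; [easy|]. split; [easy|].
  split.
  - left. split; [easy|]. split; [easy|]. exists i.
    destruct (classic (v = w)) as [->|Nvw].
    { exists 1; intuition. }
    pose proof (Hne v w Pv Pw Cv Hcone Nvw) as Nsl.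
    destruct (Hcr v w Cv Hcone) as [m [Hm Em]].
    destruct (Hcr w v Hcone Cv) as [m' [Hm' Em']].
    (* If [uv] is a constraint, the subcone meant is the one on the side of [w]. *)
    assert (Hs : exists s, (s = 1 \/ s = -1) /\
        0 < s * (slope b (vsub v u) - slope b (vsub w u))).
    { destruct (Rlt_le_dec (slope b (vsub v u)) (slope b (vsub w u)));
        [exists (-1)|exists 1]; split; auto; lra. }
    destruct Hs as [s [Hs Hsv]]. exists s. split; [easy|]. split; [easy|]. split; [easy|].
    intros x Px [Cx [Kx Sgx]] Vx. apply Lv; auto. split; [easy|]. split; [easy|].
    destruct (Hcr v x Cv Cx) as [mx [Hmx Emx]].
    destruct (Hcr w x Hcone Cx) as [my [Hmy Emy]].
    split.
    + intros c Pc Sc Cc Hb'. apply Hsb in Hb'; auto.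
      destruct (classic (c = v)) as [->|Ncv].
      * specialize (Sgx Sc). rewrite Emx in Sgx.
        assert (0 <= s * (slope b (vsub v u) - slope b (vsub x u))) by nra.
        destruct Hs as [-> | ->]; lra.
      * pose proof (Hne c v Pc Pv Cc Cv Ncv).
        specialize (Kv c Pc Sc Cc). specialize (Kx c Pc Sc Cc).
        rewrite Hsb in Kv, Kx by auto. lra.
    + intros Sw. specialize (Sgv Sw). rewrite Em' in Sgv.
      apply Rnot_lt_le; intro L. rewrite Emy in L.
      specialize (Kx w Pw Sw Hcone). apply Kx. rewrite Hsb by auto.
      assert (slope b (vsub w u) - slope b (vsub x u) < 0) by nra.
      assert (0 <= slope b (vsub w u) - slope b (vsub v u)) by nra. lra.
  - destruct (classic (v = w)) as [E|Nvw]; [now left|right].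
    pose proof (Hne v w Pv Pw Cv Hcone Nvw) as Nsl.
    destruct (Hcr w v Hcone Cv) as [m' [Hm' Em']].
    split; [apply Lv; auto|]. split.
    + intros c Pc Sc Cc Hb'. apply (Kv c Pc Sc Cc). rewrite Hsb in * by auto. lra.
    + intros r Pr Cr Sr Hb'. apply Lv; auto. split; [easy|]. split; [easy|].
      apply Hsb in Hb'; auto.
      destruct (Hcr w r Hcone Cr) as [mr [Hmr Emr]]. split.
      * intros c Pc Sc Cc Hc. apply (Kv c Pc Sc Cc). rewrite Hsb in * by auto. lra.
      * intros Sw. specialize (Sgv Sw). rewrite Em' in Sgv. rewrite Emr.
        assert (0 <= slope b (vsub w u) - slope b (vsub v u)) by nra.
        assert (0 < slope b (vsub w u) - slope b (vsub r u)) by lra. nra.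
Qed.

(** * Rotating between cones *)

(* Indexing the cone directions by all integers makes them closed under rotation by cones. *)
Definition dirz (n : nat) (z : Z) : pt :=
  (sin (IZR z * cone_angle n), cos (IZR z * cone_angle n)).

Lemma dirz_bisector n z : (0 < n)%nat -> exists i, (i < n)%nat /\ dirz n z = bisector n i.
Proof.
  intros Hn. pose proof (Z.mod_pos_bound z (Z.of_nat n) ltac:(lia)) as Hr.
  pose proof (Z.div_mod z (Z.of_nat n) ltac:(lia)) as Hz.
  set (q := (z / Z.of_nat n)%Z) in *. set (r := (z mod Z.of_nat n)%Z) in *.
  assert (Ei : IZR r = INR (Z.to_nat r)) by (rewrite INR_IZR_INZ, Z2Nat.id; [easy|lia]).
  exists (Z.to_nat r). split; [lia|].
  assert (N0 : INR n <> 0) by (apply not_0_INR; lia).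
  assert (Ez : IZR z * cone_angle n = IZR r * cone_angle n + 2 * IZR q * PI).
  { rewrite Hz, plus_IZR, mult_IZR, <- INR_IZR_INZ. unfold cone_angle. field; easy. }
  unfold dirz, bisector. rewrite <- Ei.
  (* [sin_period] counts periods by a natural number, so for a negative quotient the periods are
     added on the other side. *)
  destruct (Z_le_gt_dec 0 q) as [P|N].
  - assert (Eq : IZR q = INR (Z.to_nat q)) by (rewrite INR_IZR_INZ, Z2Nat.id; [easy|lia]).
    now rewrite Ez, Eq, sin_period, cos_period.
  - assert (Eq : - IZR q = INR (Z.to_nat (- q))).
    { rewrite INR_IZR_INZ, Z2Nat.id by lia. now rewrite opp_IZR. }
    replace (IZR r * cone_angle n) with (IZR z * cone_angle n + 2 * INR (Z.to_nat (- q)) * PI)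
      by (rewrite <- Eq; lra).
    now rewrite sin_period, cos_period.
Qed.

Lemma bisector_dirz n i : bisector n i = dirz n (Z.of_nat i).
Proof. unfold bisector, dirz. now rewrite INR_IZR_INZ. Qed.

Lemma dirz_unit n z : dot (dirz n z) (dirz n z) = 1.
Proof.
  unfold dot, dirz; simpl.
  pose proof (sin2_cos2 (IZR z * cone_angle n)) as H. unfold Rsqr in H. lra.
Qed.

(** [e] is both the mirror sign and the sense of rotation, so turning to the right by [m] cones has
    the same formulas in both orientations. *)
Lemma dirz_rotate n z e m v : (e = 1 \/ e = -1)%Z ->
  dot v (dirz n (z + e * m)) = lat (IZR e) (dirz n z) v * sin (IZR m * cone_angle n)
     + dot v (dirz n z) * cos (IZR m * cone_angle n) /\
  lat (IZR e) (dirz n (z + e * m)) v = lat (IZR e) (dirz n z) v * cos (IZR m * cone_angle n)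
     - dot v (dirz n z) * sin (IZR m * cone_angle n).
Proof.
  intros He. unfold dirz, lat, dot, perp; simpl.
  rewrite plus_IZR, mult_IZR.
  set (a := IZR z * cone_angle n).
  replace ((IZR z + IZR e * IZR m) * cone_angle n) with (a + IZR e * (IZR m * cone_angle n))
    by (unfold a; ring).
  set (w := IZR m * cone_angle n).
  destruct He as [-> | ->].
  - replace (1 * w) with w by ring. rewrite sin_plus, cos_plus. split; ring.
  - replace (-1 * w) with (- w) by ring. rewrite sin_plus, cos_plus, sin_neg, cos_neg. split; ring.
Qed.

(** * Trigonometry of 4k + 2 cones *)

Section EvenCones.
Variable k : nat.
Hypothesis Hk : (1 <= k)%nat.
Let n := (4 * k + 2)%nat.
Let th := cone_angle n.
Let d := th / 2.

(** From [(4k + 2) d = PI] comes [(2k + 1) d = PI / 2]: here the number of cones enters. *)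
Lemma cone_angle_facts : th = 2 * d /\ INR k * th + d = PI / 2 /\ 0 < d <= PI / 6.
Proof.
  assert (Hn : INR n = 4 * INR k + 2) by (unfold n; rewrite plus_INR, mult_INR; simpl; ring).
  assert (1 <= INR k) by (change 1 with (INR 1); now apply le_INR).
  pose proof PI_RGT_0.
  assert (E : d * INR n = PI) by (unfold d, th, cone_angle; field; lra).
  unfold d in *. split; [lra|]. split; [nra|]. split; nra.
Qed.

Lemma sin_cos_d : 0 < sin d /\ 0 < cos d /\ sin d * sin d + cos d * cos d = 1 /\ 2 * sin d <= 1.
Proof.
  destruct cone_angle_facts as [_ [_ [H1 H2]]]. pose proof PI_RGT_0.
  split; [apply sin_gt_0; lra|]. split; [apply cos_gt_0; lra|].
  split; [pose proof (sin2_cos2 d) as H3; unfold Rsqr in H3; lra|].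
  assert (sin d <= sin (PI / 6)); [|rewrite sin_PI6 in *; lra].
  apply sin_incr_1; lra.
Qed.

(** [2k + 1] cones make a half turn, so the opposite of a cone is again a cone. This allows a chain
    edge to be treated from its upper end. *)
Lemma dirz_opp z : forall v, dot v (dirz n (z + (2 * Z.of_nat k + 1))) = - dot v (dirz n z) /\
  forall sg, lat sg (dirz n (z + (2 * Z.of_nat k + 1))) v = - lat sg (dirz n z) v.
Proof.
  assert (E : IZR (z + (2 * Z.of_nat k + 1)) * cone_angle n = IZR z * cone_angle n + PI).
  { rewrite !plus_IZR, mult_IZR, <- INR_IZR_INZ. fold th.
    destruct cone_angle_facts as [H1 [H2 _]]. lra. }
  intro v. unfold lat, dot, perp, dirz; cbn [fst snd].
  rewrite E, neg_sin, neg_cos. split; [ring|intro; ring].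
Qed.

(** With [g = PI/4 - d/2] the factor is [cot g], and [cot g * cos x + sin x = cos (x - g) / sin g].
    The range of [phi] is [[d, 2g - d]], symmetric about [g], so [phi] is at most [g - d] away from
    [g], while [|beta|] is at least that far away. *)
Lemma cost_mid phi beta : Rabs beta <= d -> d <= phi <= PI / 2 - 2 * d ->
  (1 + sin d) / cos d * cos beta + Rabs (sin beta) <= (1 + sin d) / cos d * cos phi + sin phi.
Proof.
  intros Hb Hphi. destruct cone_angle_facts as [_ [_ Hd]]. pose proof PI_RGT_0 as HPI.
  pose (g := PI / 4 - d / 2).
  assert (Hg : d <= g) by (unfold g; lra).
  assert (Hsg : 0 < sin g) by (apply sin_gt_0; unfold g in *; lra).
  assert (Hcd : 0 < cos d) by apply sin_cos_d.
  assert (EK : (1 + sin d) / cos d = cos g / sin g).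
  { assert (E1 : sin d = cos (2 * g)).
    { rewrite <- cos_shift. f_equal. unfold g; lra. }
    assert (E2 : cos d = sin (2 * g)).
    { rewrite <- sin_shift. f_equal. unfold g; lra. }
    rewrite E2 in Hcd. rewrite E1, E2. rewrite cos_2a_cos, sin_2a in *.
    assert (cos g <> 0) by (intro Z; rewrite Z in Hcd; lra).
    assert (sin g <> 0) by lra. field. now split. }
  rewrite EK.
  assert (G : forall x, cos g / sin g * cos x + sin x = cos (x - g) / sin g).
  { intro x. rewrite cos_minus. field. lra. }
  assert (Eb : cos beta = cos (Rabs beta) /\ Rabs (sin beta) = sin (Rabs beta)).
  { unfold Rabs at 1 3. destruct (Rcase_abs beta).
    - rewrite cos_neg, sin_neg. split; [easy|].
      rewrite Rabs_left1; [easy|].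
      assert (0 <= sin (- beta)) by (apply sin_ge_0; rewrite Rabs_left in Hb; lra).
      rewrite sin_neg in *; lra.
    - split; [easy|]. rewrite Rabs_right; [easy|].
      apply Rle_ge, sin_ge_0; rewrite Rabs_right in Hb; lra. }
  destruct Eb as [-> ->]. rewrite !G.
  apply Rmult_le_compat_r; [left; now apply Rinv_0_lt_compat|].
  assert (0 <= Rabs beta) by apply Rabs_pos.
  replace (Rabs beta - g) with (- (g - Rabs beta)) by ring. rewrite cos_neg.
  destruct (Rle_lt_dec g phi).
  - apply cos_decr_1; unfold g in *; lra.
  - replace (phi - g) with (- (g - phi)) by ring. rewrite cos_neg.
    apply cos_decr_1; unfold g in *; lra.
Qed.

Lemma nearest_multiple phi : - d <= phi -> forall j, phi <= INR j * th + d ->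
  exists m, (m <= j)%nat /\ INR m * th - d <= phi <= INR m * th + d.
Proof.
  intros H0 j. destruct cone_angle_facts as [E _].
  induction j as [|j IH]; intro Hj.
  - exists 0%nat. simpl in *. split; [lia|lra].
  - destruct (Rle_lt_dec phi (INR j * th + d)) as [L|L].
    + destruct (IH L) as [m [Hm H]]. exists m. split; [lia|easy].
    + exists (S j). split; [lia|]. rewrite S_INR in *. lra.
Qed.

(* A boundary ray of one cone is perpendicular to the bisector of another one. *)
Lemma locate_cone z e v : (e = 1 \/ e = -1)%Z ->
  (forall z', dot v (dirz n z') <> 0) ->
  0 < dot v (dirz n z) -> - (dot v (dirz n z) * sin d) < lat (IZR e) (dirz n z) v * cos d ->
  exists m r phi, (m <= k)%nat /\ 0 < r /\ norm v = r /\ phi < PI / 2 /\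
    lat (IZR e) (dirz n z) v = r * sin phi /\ dot v (dirz n z) = r * cos phi /\
    INR m * th - d < phi < INR m * th + d.
Proof.
  intros He Hgp HH HX.
  destruct cone_angle_facts as [Eth [Ek Hd]]. pose proof PI_RGT_0.
  set (X := lat (IZR e) (dirz n z) v) in *. set (H0 := dot v (dirz n z)) in *.
  pose (phi := atan (X / H0)).
  destruct (atan_bound (X / H0)) as [B1 B2]. fold phi in B1, B2.
  assert (Cp : 0 < cos phi) by (apply cos_gt_0; lra).
  pose (r := H0 / cos phi).
  assert (Hr : 0 < r) by (apply Rdiv_lt_0_compat; lra).
  assert (EH : H0 = r * cos phi) by (unfold r; field; lra).
  assert (EX : X = r * sin phi).
  { assert (T : tan phi = X / H0) by apply tan_atan. unfold tan in T.
    assert (sin phi = X / H0 * cos phi) by (rewrite <- T; field; lra).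
    rewrite H1. unfold r. field. split; lra. }
  assert (Lo : - d < phi).
  { apply Rnot_le_lt; intro L.
    assert (0 <= sin (- (phi + d))) by (apply sin_ge_0; lra).
    rewrite sin_neg, sin_plus in H1.
    assert (r * (sin phi * cos d + cos phi * sin d) <= 0) by nra.
    rewrite EX, EH in HX. lra. }
  destruct (nearest_multiple phi (Rlt_le _ _ Lo) k) as [m [Hm Hphi]]; [lra|].
  exists m, r, phi. split; [easy|]. split; [easy|]. split.
  { rewrite (norm_coords (IZR e) (dirz n z) v); [|destruct He as [-> | ->]; simpl; lra|apply dirz_unit].
    fold X H0. rewrite EX, EH.
    replace (_ + _) with (r * r * ((sin phi)² + (cos phi)²)) by (unfold Rsqr; ring).
    rewrite sin2_cos2, Rmult_1_r. apply sqrt_square; lra. }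
  split; [easy|]. split; [easy|]. split; [easy|].
  (* On a boundary ray of the [m]-th cone the vector would be perpendicular to the bisector [k + 1]
     or [k] cones further back, against general position. *)
  assert (Rot : forall j, phi - IZR j * th <> PI / 2).
  { intros j E. apply (Hgp (z + e * j)%Z).
    destruct (dirz_rotate n z e j v He) as [-> _]. fold X H0 th. rewrite EX, EH.
    replace (_ + _) with (r * cos (phi - IZR j * th)) by (rewrite cos_minus; ring).
    rewrite E, cos_PI2; ring. }
  split; apply Rnot_le_lt; intro L.
  - apply (Rot (Z.of_nat m - Z.of_nat k - 1)%Z).
    rewrite !minus_IZR, <- !INR_IZR_INZ. lra.
  - apply (Rot (Z.of_nat m - Z.of_nat k)%Z).
    rewrite !minus_IZR, <- !INR_IZR_INZ. lra.
Qed.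
End EvenCones.

(** * The convex chain *)

Section Walk.
Variables (P : list pt) (S : list (pt * pt)) (u w b : pt) (sg s c : R).
Hypotheses (Hsg : sg * sg = 1) (Hb : dot b b = 1) (HS : constraints_ok P S)
  (Hnc : noncollinear P) (Pu : In u P) (Pw : In w P) (Huw : uncrossed S u w)
  (Hgp : forall p q, In p P -> In q P -> p <> q -> dot (vsub q p) b <> 0).

Let X x := lat sg b (vsub x u).
Let H x := dot (vsub x u) b.
Hypotheses (Hwl : - (H w * s) < X w * c) (Hwr : X w * c < H w * s).

Lemma lat_diff x y : lat sg b (vsub x y) = X x - X y.
Proof. unfold X, lat, dot, vsub; simpl; ring. Qed.
Lemma dot_diff x y : dot (vsub x y) b = H x - H y.
Proof. unfold H, dot, vsub; simpl; ring. Qed.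
Lemma origin_coords : X u = 0 /\ H u = 0.
Proof. unfold X, H, lat, dot, vsub; simpl; split; ring. Qed.
Lemma turn_diff x y z t : turn sg (vsub x y) (vsub z t) =
  (X x - X y) * (H z - H t) - (H x - H y) * (X z - X t).
Proof. rewrite (turn_coords sg b) by easy. now rewrite !lat_diff, !dot_diff. Qed.
Lemma turn_origin x z : turn sg (vsub x u) (vsub z u) = X x * H z - H x * X z.
Proof. rewrite turn_diff. destruct origin_coords as [-> ->]. ring. Qed.

Definition in_wedge (p r : pt) : Prop :=
  turn sg (vsub p u) (vsub r u) < 0 /\ 0 < turn sg (vsub w u) (vsub r u).

(** The invariant of the chain. The wedge between [up] and [uw] shrinks from step to step: freedom
    from constraints is inherited, and [wv_lowest] is renewed by convexity. *)
Record walk_vertex (p : pt) : Prop := {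
  wv_in : In p P;
  wv_left : 0 < turn sg (vsub w u) (vsub p u);
  wv_vis : uncrossed S u p;
  wv_pos : 0 < H p;
  wv_below : H p < H w;
  wv_cone_l : - (H p * s) < X p * c;
  wv_cone_r : X p * c < H p * s;
  wv_free : forall x, is_constraint S u x -> turn sg (vsub p u) (vsub x u) < 0 ->
     turn sg (vsub w u) (vsub x u) <= 0;
  wv_lowest : forall r, In r P -> in_wedge p r -> H p < H r }.

(* [pq] is the chain edge after [p]: the triangle bounded by [up], [pq] and [uw] is empty. *)
Record walk_step (p q : pt) : Prop := {
  ws_in : In q P;
  ws_vis : uncrossed S p q;
  ws_up : H p < H q;
  ws_top : H q <= H w;
  ws_turn : turn sg (vsub p u) (vsub q u) < 0;
  ws_left : 0 <= turn sg (vsub w u) (vsub q u);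
  ws_empty : forall r, In r P -> in_wedge p r -> 0 <= turn sg (vsub q p) (vsub r p);
  ws_next : q = w \/ (walk_vertex q /\ in_wedge p q /\
     (forall r, In r P -> r = w \/ in_wedge q r -> 0 < turn sg (vsub q p) (vsub r q) /\
        turn sg (vsub q u) (vsub r q) < 0)) }.

(** Cramer's rule: [v] expressed through [a] and [e], then mapped by the linear [g]. In the uses
    below the coefficients are positive, so a sign of [g] at [a] and [e] passes to [v]. *)
Lemma combination (g : pt -> R) a e v : 
  (forall x y m n, g (m * fst x + n * fst y, m * snd x + n * snd y) = m * g x + n * g y) ->
  turn sg a e * g v = - turn sg e v * g a + turn sg a v * g e.
Proof.
  intros Hg. rewrite <- Hg.
  replace (turn sg a e * g v) with (turn sg a e * g v + 0 * g v) by ring. rewrite <- Hg.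
  f_equal. unfold turn, cross. f_equal; ring.
Qed.

Lemma dot_linear x y m n : dot (m * fst x + n * fst y, m * snd x + n * snd y) b = m * dot x b + n * dot y b.
Proof. unfold dot; simpl; ring. Qed.
Lemma lat_linear x y m n : lat sg b (m * fst x + n * fst y, m * snd x + n * snd y)
  = m * lat sg b x + n * lat sg b y.
Proof. unfold lat, dot; simpl; ring. Qed.

(* The first vertex hit by a ray at [p] rotating from [u] towards [w]. *)
Lemma tangent_vertex p : walk_vertex p -> exists q, In q P /\ (q = w \/ in_wedge p q) /\
  forall r, In r P -> r = w \/ in_wedge p r -> 0 <= turn sg (vsub q p) (vsub r p).
Proof.
  intros Hp.
  destruct (argmin_exists
    (* The cotangent of the angle from the prolongation of [up] beyond [p] to [pr]. The least
       cotangent belongs to the direction closest to [pu]. *)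
    (fun r => dot (vsub p u) (vsub r p) / (- turn sg (vsub p u) (vsub r p)))
    (fun r => r = w \/ in_wedge p r) P) as [q [Pq [Wq Lq]]]; [exists w; auto|].
  exists q. split; [easy|]. split; [easy|]. intros r Pr Wr. specialize (Lq r Pr Wr). cbv beta in Lq.
  assert (T : forall x, x = w \/ in_wedge p x -> turn sg (vsub p u) (vsub x p) < 0).
  { intros x Hx. replace (turn sg (vsub p u) (vsub x p)) with (turn sg (vsub p u) (vsub x u))
      by (unfold turn, cross, vsub; simpl; ring).
    destruct Hx as [-> | [Hx _]]; [|easy]. rewrite turn_anti. pose proof (wv_left p Hp). lra. }
  assert (I : dot (vsub p u) (vsub q p) * turn sg (vsub p u) (vsub r p)
     - dot (vsub p u) (vsub r p) * turn sg (vsub p u) (vsub q p)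
     = dot (vsub p u) (vsub p u) * turn sg (vsub q p) (vsub r p))
    by (unfold dot, turn, cross; ring).
  pose proof (T q Wq) as Tq. pose proof (T r Wr) as Tr.
  set (tq := turn sg (vsub p u) (vsub q p)) in *. set (tr := turn sg (vsub p u) (vsub r p)) in *.
  set (dq := dot (vsub p u) (vsub q p)) in *. set (dr := dot (vsub p u) (vsub r p)) in *.
  assert (L2 : dq * - tr <= dr * - tq).
  { apply Rmult_le_compat_r with (r := - tq * - tr) in Lq; [|nra].
    replace (dq / - tq * (- tq * - tr)) with (dq * - tr) in Lq by (field; lra).
    replace (dr / - tr * (- tq * - tr)) with (dr * - tq) in Lq by (field; lra). easy. }
  assert (0 < dot (vsub p u) (vsub p u)).
  { pose proof (wv_pos p Hp) as Hpos. unfold H, dot in Hpos. unfold dot.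
    apply Rnot_le_lt; intro L.
    assert (fst (vsub p u) = 0) by nra. assert (snd (vsub p u) = 0) by nra.
    rewrite H0, H1 in Hpos. lra. }
  nra.
Qed.

(** Let [q] be the tangent vertex. The part of the wedge beyond the line [pq], on the side of [u],
    is empty, so [wedge_uncrossed] with that line as [f] shows that both [pq] and [uq] are
    uncrossed. *)
Lemma next_vertex p : walk_vertex p -> exists q, walk_step p q.
Proof.
  intros Hp. destruct (tangent_vertex p Hp) as [q [Pq [Wq Eq]]]. exists q.
  destruct Hp as [Pp Lp Vp Hp0 Hpw Cl Cr Fp Lowp].
  destruct origin_coords as [Xu Hu].
  assert (Nwp : w <> p) by (intros ->; lra).
  assert (Nup : u <> p) by (intros ->; lra).
  assert (Nuw : u <> w) by (intros ->; lra).
  assert (Tpq : turn sg (vsub p u) (vsub q u) < 0).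
  { destruct Wq as [-> | [W _]]; [|easy]. rewrite turn_anti; lra. }
  assert (Twq : 0 <= turn sg (vsub w u) (vsub q u)).
  { destruct Wq as [-> | [_ W]]; [|lra]. unfold turn, cross; lra. }
  assert (Npq : p <> q) by (intros <-; unfold turn, cross in Tpq; lra).
  assert (Nuq : u <> q) by (intros <-; rewrite turn_origin, Xu, Hu in Tpq; lra).
  assert (Up : H p < H q).
  { destruct Wq as [-> | W]; auto. }
  assert (Fu : turn sg (vsub q p) (vsub u p) < 0).
  { replace (turn sg (vsub q p) (vsub u p)) with (turn sg (vsub p u) (vsub q u)); [easy|].
    unfold turn, cross, vsub; simpl; ring. }
  assert (Fp0 : turn sg (vsub q p) (vsub p p) = 0) by (unfold turn, cross, vsub; simpl; ring).
  assert (Fq0 : turn sg (vsub q p) (vsub q p) = 0) by (unfold turn, cross, vsub; simpl; ring).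
  assert (Fw : 0 <= turn sg (vsub q p) (vsub w p)) by auto.
  assert (Af : affine (fun x => turn sg (vsub q p) (vsub x p))) by apply affine_turn.
  assert (Seg : forall a, (forall t, 0 < t < 1 -> 
        turn sg (vsub p u) (vsub (lerp t a q) u) < 0 /\
        0 < turn sg (vsub w u) (vsub (lerp t a q) u) /\ 
        turn sg (vsub q p) (vsub (lerp t a q) p) <= 0) ->
      (forall c d, properly_intersect a q c d ->
        turn sg (vsub q p) (vsub c p) < 0 \/ turn sg (vsub q p) (vsub d p) < 0) ->
      uncrossed S a q).
  { intros a Ha Hcr.
    apply (wedge_uncrossed sg P S u p w (fun x => turn sg (vsub q p) (vsub x p))); auto.
    - lra.
    - intros x Px W1 W2. apply Eq; auto. right; split; auto. }
  assert (Dir : forall r, In r P -> r <> q -> r = w \/ in_wedge q r -> 0 < turn sg (vsub w u) (vsub q u) ->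
     0 < turn sg (vsub q p) (vsub r q) /\ turn sg (vsub q u) (vsub r q) < 0).
  { intros r Pr Nr Wr Tw.
    assert (turn sg (vsub q u) (vsub r u) < 0).
    { destruct Wr as [-> | [W _]]; [|easy]. rewrite turn_anti; lra. }
    assert (r = w \/ in_wedge p r).
    { destruct Wr as [E | [W1 W2]]; [now left|right]. split; [|easy].
      pose proof (combination (fun x => turn sg (vsub p u) x) (vsub w u) (vsub q u) (vsub r u)
        ltac:(intros; unfold turn, cross; simpl; ring)) as I.
      cbv beta in I. rewrite (turn_anti sg (vsub p u) (vsub w u)) in I. nra. }
    assert (Ge : 0 <= turn sg (vsub q p) (vsub r p)) by auto.
    assert (r <> p).
    { intros ->. rewrite turn_anti in H0. lra. }
    assert (Nz : turn sg (vsub q p) (vsub r p) <> 0).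
    { intro Z. apply (Hnc p q r); auto. unfold turn in Z. nra. }
    split.
    - replace (turn sg (vsub q p) (vsub r q)) with (turn sg (vsub q p) (vsub r p)); [lra|].
      unfold turn, cross, vsub; simpl; ring.
    - replace (turn sg (vsub q u) (vsub r q)) with (turn sg (vsub q u) (vsub r u)); [easy|].
      unfold turn, cross, vsub; simpl; ring. }
  (* [r - q] is a positive combination of [q - p] and [q - u], and both of these go up. *)
  assert (Rise : forall r, In r P -> r <> q -> r = w \/ in_wedge q r -> 0 < turn sg (vsub w u) (vsub q u) ->
     H q < H r).
  { intros r Pr Nr Wr Tw. destruct (Dir r Pr Nr Wr Tw) as [D1 D2].
    pose proof (combination (fun x => dot x b) (vsub q p) (vsub q u) (vsub r q) dot_linear) as I.
    cbv beta in I. rewrite !dot_diff, Hu in I.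
    assert (turn sg (vsub q p) (vsub q u) = - turn sg (vsub p u) (vsub q u))
      by (unfold turn, cross, vsub; simpl; ring).
    rewrite H0 in I. apply Rnot_le_lt; intro L. nra. }
  assert (Nsegq : q = w \/ 0 < turn sg (vsub w u) (vsub q u)) by (destruct Wq as [?|[_ W]]; auto).
  constructor; auto.
  - apply Seg.
    + intros t Ht.
      rewrite (affine_turn sg (vsub p u) u t p q), (affine_turn sg (vsub w u) u t p q),
       (affine_turn sg (vsub q p) p t p q). cbv beta. rewrite Fp0, Fq0.
      assert (turn sg (vsub p u) (vsub p u) = 0) by (unfold turn, cross; ring). rewrite H0.
      split; [nra|]. split; [nra|lra].
    + intros x y [Hx _].
      replace (cross (vsub q p) (vsub x p) * cross (vsub q p) (vsub y p)) with
        ((sg * sg) * (cross (vsub q p) (vsub x p) * cross (vsub q p) (vsub y p))) in Hx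
        by (rewrite Hsg; ring).
      unfold turn. destruct (Rlt_le_dec (sg * cross (vsub q p) (vsub x p)) 0); [now left|right].
      nra.
  - destruct Nsegq as [-> | N]; [lra|]. left. apply Rise; auto.
    intros ->. unfold turn, cross in N. lra.
  - destruct Wq as [Q | Wq]; [now left|right]. destruct Nsegq as [-> | Tw].
    { destruct Wq as [_ W]. unfold turn, cross in W. lra. }
    assert (Nqw : w <> q) by (intros <-; unfold turn, cross in Tw; lra).
    assert (Comb : forall r, in_wedge q r -> turn sg (vsub p u) (vsub r u) < 0).
    { intros r [W1 W2].
      pose proof (combination (fun x => turn sg (vsub p u) x) (vsub w u) (vsub q u) (vsub r u)
        ltac:(intros; unfold turn, cross; simpl; ring)) as I.
      cbv beta in I. rewrite (turn_anti sg (vsub p u) (vsub w u)) in I. nra. }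
    split; [|split; [easy|]].
    + constructor; auto.
      * apply Seg.
        -- intros t Ht.
           rewrite (affine_turn sg (vsub p u) u t u q), (affine_turn sg (vsub w u) u t u q),
             (affine_turn sg (vsub q p) p t u q). cbv beta. rewrite Fq0.
           assert (Z : forall v, turn sg v (vsub u u) = 0)
             by (intro; unfold turn, cross, vsub; simpl; ring).
           rewrite !Z. split; [nra|]. split; nra.
        -- intros x y Hx. destruct (properly_intersect_lerp _ _ _ _ Hx) as [t [t' [Ht [Ht' E]]]].
           assert (A1 := Af t u q). assert (A2 := Af t' x y). cbv beta in A1, A2.
           rewrite E, A2, Fq0 in A1.
           destruct (Rlt_le_dec (turn sg (vsub q p) (vsub x p)) 0); [now left|right].
           apply Rnot_le_lt; intro L. nra.
      * lra.
      (* [q - u] is a positive combination of [w - u] and [p - u], and both of these lie in the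
         cone. *)
      * pose proof (combination (fun v => lat sg b v * c + dot v b * s) (vsub w u) (vsub p u) (vsub q u)
          ltac:(intros; cbv beta; rewrite lat_linear, dot_linear; ring)) as I.
        cbv beta in I. fold (X w) (H w) (X p) (H p) (X q) (H q) in I.
        apply Rnot_le_lt; intro L. nra.
      * pose proof (combination (fun v => dot v b * s - lat sg b v * c) (vsub w u) (vsub p u) (vsub q u)
          ltac:(intros; cbv beta; rewrite lat_linear, dot_linear; ring)) as I.
        cbv beta in I. fold (X w) (H w) (X p) (H p) (X q) (H q) in I.
        apply Rnot_le_lt; intro L. nra.
      * intros x Cx Tx. apply Rnot_lt_le; intro L. specialize (Fp x Cx).
        assert (turn sg (vsub p u) (vsub x u) < 0) by (apply Comb; now split). lra.
      * intros r Pr Wr. apply Rise; auto. intros ->. destruct Wr as [W _].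
        unfold turn, cross in W; lra.
    + intros r Pr Wr. apply Dir; auto. intros ->. destruct Wr as [W | [W _]]; [congruence|].
      unfold turn, cross in W; lra.
Qed.
End Walk.

(** * The induction *)

Lemma theta_edge_sym n P S a b : theta_edge n P S a b -> theta_edge n P S b a.
Proof. unfold theta_edge; tauto. Qed.

Lemma in_sector_iff n b sg v : sg * sg = 1 -> dot b b = 1 ->
  0 < sin (cone_angle n / 2) -> 0 < cos (cone_angle n / 2) ->
  in_sector n b v <-> - (dot v b * sin (cone_angle n / 2)) < lat sg b v * cos (cone_angle n / 2)
     < dot v b * sin (cone_angle n / 2).
Proof.
  intros Hsg Hb Hs Hc. unfold in_sector. rewrite (norm_coords sg b v) by easy.
  apply sector_iff; auto. pose proof (sin2_cos2 (cone_angle n / 2)) as H. unfold Rsqr in H. lra.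
Qed.

Lemma sign_IZR e : (e = 1 \/ e = -1)%Z -> IZR e = 1 \/ IZR e = -1.
Proof. intros [-> | ->]; auto. Qed.

Lemma Rabs_lat sg b v : sg = 1 \/ sg = -1 -> Rabs (dot v (perp b)) = Rabs (lat sg b v).
Proof.
  unfold lat. intros [-> | ->]; [f_equal; ring|].
  rewrite <- Rabs_Ropp; f_equal; ring.
Qed.

(** This concerns the part of the canonical triangle [T_uw] right of [uw]; the height of [w] stands
    for the side opposite [u]. *)
Definition right_empty (n : nat) (P : list pt) (b : pt) (sg : R) (u w : pt) : Prop :=
  forall r, In r P -> in_sector n b (vsub r u) -> dot (vsub r u) b < dot (vsub w u) b ->
    0 <= turn sg (vsub w u) (vsub r u).

Definition spans (n : nat) (P : list pt) (S : list (pt * pt)) (K : R) (b u w : pt) : Prop :=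
  sees S u w -> in_sector n b (vsub w u) ->
  linked (theta_edge n P S) u w (K * dot (vsub w u) b + Rabs (dot (vsub w u) (perp b))) /\
  forall sg, sg = 1 \/ sg = -1 -> right_empty n P b sg u w ->
    linked (theta_edge n P S) u w (K * dot (vsub w u) b + lat sg b (vsub w u)).

Section Induction.
Variables (k : nat) (P : list pt) (S : list (pt * pt)).
Let n := (4 * k + 2)%nat.
Let th := cone_angle n.
Let s := sin (th / 2).
Let c := cos (th / 2).
Let K := (1 + s) / c.
Hypotheses (Hk : (1 <= k)%nat) (HS : constraints_ok P S) (Hnc : noncollinear P)
  (Hgp : forall p q z, In p P -> In q P -> p <> q -> dot (vsub q p) (dirz n z) <> 0).

Lemma sc_facts : 0 < s /\ 0 < c /\ s * s + c * c = 1 /\ 2 * s <= 1 /\ 0 < K.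
Proof.
  destruct (sin_cos_d k Hk) as [H1 [H2 [H3 H4]]]. fold n th s c in H1, H2, H3, H4.
  repeat split; auto. apply Rdiv_lt_0_compat; lra.
Qed.

Lemma sector_coords z sg v : sg * sg = 1 -> in_sector n (dirz n z) v <->
   - (dot v (dirz n z) * s) < lat sg (dirz n z) v * c < dot v (dirz n z) * s.
Proof.
  intro Hsg. destruct sc_facts as [H1 [H2 _]].
  apply in_sector_iff; auto using dirz_unit.
Qed.

(** * The cost of one chain edge *)

Section Step.
Variables (u w : pt) (z e : Z).
Let b := dirz n z.
Let sg := IZR e.
Hypotheses (He : (e = 1 \/ e = -1)%Z) (Pu : In u P) (Pw : In w P) (Huw : uncrossed S u w)
  (Hsec : in_sector n b (vsub w u)).
Hypothesis IH : forall x y z', In x P -> In y P ->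
  dot (vsub y x) (dirz n z') < dot (vsub w u) b -> spans n P S K (dirz n z') x y.

Let X x := lat sg b (vsub x u).
Let H x := dot (vsub x u) b.
Let vertex := walk_vertex P S u w b sg s c.
Let step := walk_step P S u w b sg s c.

Lemma sg_sq : sg * sg = 1.
Proof. apply sign_sq, sign_IZR, He. Qed.

Lemma target_coords : - (H w * s) < X w * c < H w * s.
Proof. apply (sector_coords z sg), Hsec. apply sg_sq. Qed.

Lemma vertex_coords p : vertex p -> 0 < H p /\ H p < H w /\ - (H p * s) < X p * c < H p * s.
Proof. intros []. repeat split; assumption. Qed.

Lemma step_coords p q : step p q -> H p < H q <= H w /\ X p * H q - H p * X q < 0 /\
  0 <= X w * H q - H w * X q.
Proof.
  intros [_ _ H1 H2 H3 H4 _ _].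
  rewrite (turn_origin u b sg sg_sq (dirz_unit n z)) in H3, H4.
  repeat split; assumption.
Qed.

Lemma step_right p q : vertex p -> step p q -> X q * c < H q * s.
Proof.
  intros Hp Hq. destruct (ws_next _ _ _ _ _ _ _ _ _ _ Hq) as [-> | [V _]].
  - apply target_coords.
  - apply (vertex_coords _ V).
Qed.

Lemma edge_coords p q : lat sg b (vsub q p) = X q - X p /\ dot (vsub q p) b = H q - H p.
Proof. split; [apply lat_diff|apply dot_diff]. Qed.

(** [up] points to the right of the left boundary ray of the cone of [u], and [pq] rises and turns
    right from [up], so [pq] points to the right of that ray as well. *)
Lemma step_direction p q : vertex p -> step p q ->
  X p * H q - H p * X q < 0 /\ - ((H q - H p) * s) < (X q - X p) * c.
Proof.
  intros Hp Hq. destruct sc_facts as [Hs [Hc _]].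
  destruct (vertex_coords p Hp) as [Hpos [_ [Hl Hr]]].
  destruct (step_coords p q Hq) as [[Hup Htop] [Hturn Hlf]].
  split; [exact Hturn|]. apply Rnot_le_lt; intro L.
  assert (E : H p * ((X q - X p) * c + (H q - H p) * s) =
    c * (H p * X q - X p * H q) + (H q - H p) * (X p * c + H p * s)) by ring.
  assert (0 < c * (H p * X q - X p * H q)) by (apply Rmult_lt_0_compat; lra).
  assert (0 < (H q - H p) * (X p * c + H p * s)) by (apply Rmult_lt_0_compat; lra).
  assert (0 < H p * ((X q - X p) * c + (H q - H p) * s)) by lra. nra.
Qed.

(** This makes the induction hypothesis available for [pq] in a cone turned by [a], whose height is
    measured along another bisector. *)
Lemma step_projection p q a : vertex p -> step p q -> th <= a <= PI / 2 - th / 2 ->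
  (X q - X p) * sin a + (H q - H p) * cos a < H w.
Proof.
  intros Hp Hq Ha. destruct sc_facts as [Hs [Hc [Hsc [Hs2 _]]]].
  destruct (cone_angle_facts k Hk) as [_ [_ [D1 D2]]]. fold n th in D1, D2. pose proof PI_RGT_0.
  pose proof (step_right p q Hp Hq) as Hqr.
  destruct (vertex_coords p Hp) as [Hpos [_ [Hl Hr]]].
  destruct (step_coords p q Hq) as [[Hup Htop] [Hturn Hlf]].
  assert (Sa : 0 < sin a) by (apply sin_gt_0; lra).
  assert (Ca : 0 < cos a) by (apply cos_gt_0; lra).
  assert (Sc : sin a <= c).
  { unfold c. rewrite <- sin_shift. apply sin_incr_1; lra. }
  assert (Cc : s * sin a + c * cos a <= c).
  { replace (s * sin a + c * cos a) with (cos (a - th / 2)) by (rewrite cos_minus; unfold s, c; ring).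
    apply cos_decr_1; lra. }
  set (Sn := sin a) in *. set (Cn := cos a) in *. clearbody Sn Cn.
  assert (B : c * ((X q - X p) * Sn + (H q - H p) * Cn) <
     H q * (s * Sn + c * Cn) + H p * (s * Sn - c * Cn)).
  { assert (0 < Sn * ((H q * s - X q * c) + (X p * c + H p * s))) by (apply Rmult_lt_0_compat; lra). lra. }
  (* The left side is affine in [H p], between 0 and [H q]. At 0 the bound is [cos (a - th/2) <= c],
     at [H q] it is [2 s sin a <= c]. *)
  assert (B2 : H q * (s * Sn + c * Cn) + H p * (s * Sn - c * Cn) <= H q * c).
  { destruct (Rle_lt_dec (s * Sn - c * Cn) 0).
    - assert (H p * (s * Sn - c * Cn) <= 0) by nra. nra.
    - assert (H p * (s * Sn - c * Cn) <= H q * (s * Sn - c * Cn)) by nra.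
      assert (2 * s * Sn <= c) by nra. nra. }
  apply Rmult_lt_reg_l with c; [easy|]. nra.
Qed.

(** A vertex violating the claim lies in the cone of [u], below [w] and right of [up]. Right of [uw]
    it contradicts the emptiness at [u], on [uw] noncollinearity, and left of [uw] the emptiness in
    [walk_step]. *)
Lemma step_right_empty p q : vertex p -> step p q ->
  right_empty n P b sg u w -> right_empty n P b sg p q.
Proof.
  intros Hp Hq Hem r Pr Sr Lr. apply Rnot_lt_le; intro T.
  destruct sc_facts as [Hs [Hc [Hsc [Hs2 _]]]].
  assert (TO := turn_origin u b sg sg_sq (dirz_unit n z)).
  assert (TD := turn_diff u b sg sg_sq (dirz_unit n z)).
  apply (sector_coords z sg) in Sr; [|apply sg_sq]. fold b in Sr.
  destruct (edge_coords p r) as [E1 E2]. destruct (edge_coords p q) as [E3 E4].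
  rewrite E1, E2 in Sr. rewrite E2, E4 in Lr.
  rewrite TD in T. fold (X p) (H p) (X q) (H q) (X r) (H r) in T.
  destruct (vertex_coords p Hp) as [Hpos [_ [Hl Hr]]].
  destruct (step_coords p q Hq) as [[Hup Htop] [Hturn Hlf]].
  destruct (step_direction p q Hp Hq) as [Tq _].
  assert (Hpr : 0 < H r - H p) by nra.
  assert (W1 : turn sg (vsub p u) (vsub r u) < 0).
  { rewrite TO. fold (X p) (H p) (X r) (H r).
    assert ((H q - H p) * (X p * H r - H p * X r) =
      (H r - H p) * (X p * H q - H p * X q) +
      H p * ((X q - X p) * (H r - H p) - (H q - H p) * (X r - X p))) by ring.
    assert ((H r - H p) * (X p * H q - H p * X q) < 0) by nra.
    assert (H p * ((X q - X p) * (H r - H p) - (H q - H p) * (X r - X p)) < 0) by nra.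
    apply Rnot_le_lt; intro L. nra. }
  assert (Nru : r <> u).
  { intros ->. assert (H u = 0) by apply (origin_coords u b sg). lra. }
  assert (Nrw : r <> w) by (intros ->; lra).
  assert (Nuw : u <> w).
  { intros E. assert (H u = 0) by apply (origin_coords u b sg). rewrite E in *. lra. }
  destruct (Rtotal_order (turn sg (vsub w u) (vsub r u)) 0) as [L|[E|G]].
  - assert (0 <= turn sg (vsub w u) (vsub r u)); [|lra].
    apply Hem; auto.
    + apply (sector_coords z sg); [apply sg_sq|]. fold b (X r) (H r). split; lra.
    + fold (H r) (H w). lra.
  - apply (Hnc u w r); auto. pose proof sg_sq. unfold turn in E. nra.
  - pose proof (ws_empty _ _ _ _ _ _ _ _ _ _ Hq r Pr (conj W1 G)) as T2.
    rewrite TD in T2. fold (X p) (H p) (X q) (H q) (X r) (H r) in T2. lra.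
Qed.

(* The canonical triangle with apex [q] has one side through [p] parallel to a boundary ray of
   the cone of [u], which keeps its lower part inside the region emptied by [walk_step]. *)
Lemma step_below_empty p q b' : vertex p -> step p q -> 
  (forall v, dot v b' = - (lat sg b v * c + dot v b * s) /\
     lat sg b' v = - (lat sg b v * s - dot v b * c)) ->
  (forall v, in_sector n b' v <-> - (dot v b' * s) < lat sg b' v * c < dot v b' * s) ->
  right_empty n P b' (- sg) q p.
Proof.
  intros Hp Hq Hb' Hsb r Pr Sr Lr. apply Rnot_lt_le; intro T.
  destruct sc_facts as [Hs [Hc [Hsc [Hs2 _]]]].
  assert (TO := turn_origin u b sg sg_sq (dirz_unit n z)).
  assert (TD := turn_diff u b sg sg_sq (dirz_unit n z)).
  apply Hsb in Sr. 
  destruct (edge_coords q r) as [E1 E2]. destruct (edge_coords q p) as [E3 E4].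
  destruct (Hb' (vsub r q)) as [R1 R2]. destruct (Hb' (vsub p q)) as [R3 R4].
  rewrite R1, R2, E1, E2 in Sr. rewrite R1, R3, E1, E2, E3, E4 in Lr.
  rewrite turn_neg, TD in T. fold (X p) (H p) (X q) (H q) (X r) (H r) in T.
  destruct (vertex_coords p Hp) as [Hpos [_ [Hl Hr]]].
  destruct (step_coords p q Hq) as [[Hup Htop] [Hturn Hlf]].
  destruct (step_direction p q Hp Hq) as [Tq Dq].
  destruct target_coords as [Wl Wr].
  assert (Hw : 0 < H w) by nra.
  (* The upper boundary ray of this cone at [q] is perpendicular to [b]. *)
  assert (hneg : H r - H q < 0).
  { assert (E : (H r - H q) * (s * s + c * c) < 0) by lra. rewrite Hsc in E. lra. }
  assert (A : 2 * s * c * (X r - X q) < (H r - H q) * (c * c - s * s)) by lra.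
  assert (W1 : turn sg (vsub p u) (vsub r u) < 0).
  { rewrite TO. fold (X p) (H p) (X r) (H r).
    assert (I : ((X q - X p) * c + (H q - H p) * s) * (X p * H r - H p * X r) =
       (X p * H q - H p * X q) * ((X r - X p) * c + (H r - H p) * s)
       + ((X q - X p) * (H r - H p) - (H q - H p) * (X r - X p)) * (X p * c + H p * s)) by ring.
    assert (0 < (X r - X p) * c + (H r - H p) * s) by lra.
    assert ((X q - X p) * (H r - H p) - (H q - H p) * (X r - X p) < 0) by lra.
    assert ((X p * H q - H p * X q) * ((X r - X p) * c + (H r - H p) * s) < 0) by nra.
    assert (((X q - X p) * (H r - H p) - (H q - H p) * (X r - X p)) * (X p * c + H p * s) < 0) by nra.
    apply Rnot_le_lt; intro L. nra. }
  assert (W2 : 0 < turn sg (vsub w u) (vsub r u)).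
  { rewrite TO. fold (X w) (H w) (X r) (H r).
    (* Seen from [q], the vertex [r] is not right of the line parallel to the right boundary ray of
       the cone of [u]. This holds because [th/2 <= PI/6], used as [4 s^2 <= 1]. *)
    assert (B1 : 0 <= s * (H r - H q) - c * (X r - X q)).
    { assert (B : (H r - H q) * (4 * (s * s) - 1) < 2 * s * (s * (H r - H q) - c * (X r - X q))).
      { replace 1 with (s * s + c * c). lra. }
      assert (4 * (s * s) - 1 <= 0) by nra.
      assert (0 <= (H r - H q) * (4 * (s * s) - 1)) by nra. nra. }
    assert (B2 : 0 < c * (X w * (H r - H q) - H w * (X r - X q))).
    { assert (H w * s * (H r - H q) < X w * c * (H r - H q)) by nra.
      assert (0 <= H w * (s * (H r - H q) - c * (X r - X q))) by nra. lra. }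
    assert (0 < X w * (H r - H q) - H w * (X r - X q)) by nra. lra. }
  pose proof (ws_empty _ _ _ _ _ _ _ _ _ _ Hq r Pr (conj W1 W2)) as T2.
  rewrite TD in T2. fold (X p) (H p) (X q) (H q) (X r) (H r) in T2. lra.
Qed.

Lemma step_cost p q : vertex p -> step p q ->
  (0 <= X q - X p -> linked (theta_edge n P S) p q (K * (H q - H p) + (X q - X p))) /\
  (X q - X p < 0 -> linked (theta_edge n P S) p q (K * (H q - H p) - (X q - X p))) /\
  (right_empty n P b sg u w -> linked (theta_edge n P S) p q (K * (H q - H p) + (X q - X p))).
Proof.
  intros Hp Hq.
  destruct sc_facts as [Hs [Hc [Hsc [Hs2 HK]]]].
  destruct (cone_angle_facts k Hk) as [_ [Ek [D1 D2]]]. fold n th in Ek, D1, D2.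
  pose proof PI_RGT_0 as HPI.
  pose proof (wv_in _ _ _ _ _ _ _ _ _ Hp) as Pp.
  pose proof (ws_in _ _ _ _ _ _ _ _ _ _ Hq) as Pq.
  destruct (vertex_coords p Hp) as [Hpos [_ [Hl Hr]]].
  destruct (step_coords p q Hq) as [[Hup Htop] [Hturn Hlf]].
  pose proof (ws_vis _ _ _ _ _ _ _ _ _ _ Hq) as Hvis.
  assert (Npq : p <> q) by (intros ->; lra).
  assert (Vpq : sees S p q) by (right; exact Hvis).
  assert (Vqp : sees S q p) by (right; apply uncrossed_sym, Hvis).
  destruct (edge_coords p q) as [E1 E2].
  destruct (step_direction p q Hp Hq) as [_ Dq].
  destruct (locate_cone k Hk z e (vsub q p) He) as [m [r [phi [Hm [Hr0 [En [Hphi [EX [EH Hmp]]]]]]]]].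
  { intro z'. apply Hgp; auto. }
  { fold n b. rewrite E2. lra. }
  { fold n b sg th s c. now rewrite E1, E2. }
  fold n b sg th in EX, EH, Hmp. 
  destruct (dirz_rotate n z e (Z.of_nat m) (vsub q p) He) as [Rd Rl].
  fold n b sg th in Rd, Rl. rewrite <- INR_IZR_INZ in Rd, Rl.
  assert (Cosb : cos (th / 2) < cos (phi - INR m * th)).
  { assert (cos (phi - INR m * th) = cos (Rabs (phi - INR m * th))) as ->.
    { unfold Rabs; destruct Rcase_abs; [now rewrite cos_neg|easy]. }
    assert (Rabs (phi - INR m * th) < th / 2) by (apply Rabs_def1; lra).
    pose proof (Rabs_pos (phi - INR m * th)).
    apply cos_decreasing_1; lra. }
  assert (Rd' : dot (vsub q p) (dirz n (z + e * Z.of_nat m)) = r * cos (phi - INR m * th)).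
  { rewrite Rd, EX, EH, cos_minus. ring. }
  assert (Rl' : lat sg (dirz n (z + e * Z.of_nat m)) (vsub q p) = r * sin (phi - INR m * th)).
  { rewrite Rl, EX, EH, sin_minus. ring. }
  assert (Hsect : in_sector n (dirz n (z + e * Z.of_nat m)) (vsub q p)).
  { unfold in_sector. rewrite En, Rd'. fold th. nra. }
  destruct (Nat.eq_dec m 0) as [-> | Nm].
  { replace (z + e * Z.of_nat 0)%Z with z in * by lia. fold b in Hsect.
    assert (Hlow : dot (vsub q p) b < dot (vsub w u) b) by (rewrite E2; change (H q - H p < H w); lra).
    destruct (IH p q z Pp Pq Hlow Vpq Hsect) as [I1 I2].
    fold b in I1, I2. rewrite (Rabs_lat sg) in I1 by (apply sign_IZR, He).
    rewrite E1, E2 in I1. split; [|split].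
    - intro L. now rewrite Rabs_right in I1 by lra.
    - intro L. now rewrite Rabs_left in I1 by lra.
    - intro Hem. rewrite <- E1, <- E2. apply I2; [apply sign_IZR, He|].
      now apply step_right_empty. }
  assert (Hm1 : 1 <= INR m) by (change 1 with (INR 1); apply le_INR; lia).
  assert (Hmk : INR m <= INR k) by now apply le_INR.
  assert (Hphi0 : th / 2 < phi) by nra.
  assert (Xpos : 0 <= X q - X p).
  { rewrite <- E1, EX. assert (0 < sin phi) by (apply sin_gt_0; lra). nra. }
  assert (Hmth : th <= INR m * th <= PI / 2 - th / 2) by (split; nra).
  assert (Hproj : dot (vsub q p) (dirz n (z + e * Z.of_nat m)) < dot (vsub w u) b).
  { rewrite Rd, E1, E2. apply step_projection; auto. }
  (* For [m >= 1] the edge goes to the right, so the three claims reduce to one. *)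
  enough (Goal : linked (theta_edge n P S) p q (K * (H q - H p) + (X q - X p)))
    by (split; [easy|split; [lra|easy]]).
  destruct (Nat.eq_dec m k) as [-> | Nk].
  (* The bisector opposite to that of the [k]-th cone: its cone at [q] contains [p]. *)
  - set (z' := (z + e * Z.of_nat k + (2 * Z.of_nat k + 1))%Z).
    assert (Hb' : forall v, dot v (dirz n z') = - (lat sg b v * c + dot v b * s) /\
       lat sg (dirz n z') v = - (lat sg b v * s - dot v b * c)).
    { intro v. destruct (dirz_opp k Hk (z + e * Z.of_nat k) v) as [O1 O2]. fold n z' in O1, O2.
      destruct (dirz_rotate n z e (Z.of_nat k) v He) as [O3 O4]. fold th b sg in O3, O4.
      rewrite <- INR_IZR_INZ in O3, O4.
      rewrite O1, O2, O3, O4. 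
      replace (INR k * th) with (PI / 2 - th / 2) by lra.
      rewrite sin_shift, cos_shift. split; reflexivity. }
    destruct (dirz_opp k Hk (z + e * Z.of_nat k) (vsub p q)) as [O1 _]. fold n z' in O1.
    assert (Vn : forall b0, dot (vsub p q) b0 = - dot (vsub q p) b0)
      by (intro; unfold dot, vsub; simpl; ring).
    assert (Op : dot (vsub p q) (dirz n z') = dot (vsub q p) (dirz n (z + e * Z.of_nat k)))
      by (rewrite O1, Vn; ring).
    apply linked_sym; [apply theta_edge_sym|].
    destruct (IH q p z' Pq Pp) as [_ I2]; [rewrite Op; easy|easy| |].
    { unfold in_sector. rewrite Op. fold (pdist p q). rewrite pdist_sym. exact Hsect. }
    assert (Sg' : - sg = 1 \/ - sg = -1) by (destruct (sign_IZR e He) as [G|G]; fold sg in G; rewrite G; lra).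
    specialize (I2 (- sg) Sg').
    assert (I3 : right_empty n P (dirz n z') (- sg) q p).
    { apply step_below_empty; auto. intro v. apply sector_coords, sg_sq. }
    apply I2 in I3. clear I2. apply (linked_le _ _ _ _ _ I3). right.
    destruct (Hb' (vsub p q)) as [B1 B2].
    replace (lat (- sg) (dirz n z') (vsub p q)) with (- lat sg (dirz n z') (vsub p q))
      by (unfold lat; ring).
    rewrite B1, B2. destruct (edge_coords q p) as [E3 E4]. rewrite E3, E4.
    (* The bound at [q] is [K (c dx + s dh) + c dh - s dx]. It equals [K dh + dx], because
       [K c - s = 1] and [K s + c = K]. *)
    unfold K. apply Rmult_eq_reg_r with c; [|lra].
    field_simplify; [|lra|lra]. replace (c ^ 2) with (1 - s * s) by lra. ring.
  - destruct (IH p q (z + e * Z.of_nat m)%Z Pp Pq Hproj Vpq Hsect) as [I1 _].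
    apply (linked_le _ _ _ _ _ I1).
    rewrite (Rabs_lat sg) by (apply sign_IZR, He). rewrite Rd', Rl'.
    rewrite <- E1, <- E2, EX, EH.
    assert (Hmk' : INR m + 1 <= INR k).
    { rewrite <- S_INR. apply le_INR. lia. }
    assert (C : K * cos (phi - INR m * th) + Rabs (sin (phi - INR m * th)) <= K * cos phi + sin phi).
    { apply (cost_mid k Hk); fold n th; [apply Rabs_le; lra|nra]. }
    rewrite Rabs_mult, (Rabs_right r) by lra.
    assert (r * (K * cos (phi - INR m * th) + Rabs (sin (phi - INR m * th))) <= r * (K * cos phi + sin phi))
      by (apply Rmult_le_compat_l; lra). lra.
Qed.

(** Later directions [r - q] are positive combinations of [q - p] and [q - u], and neither of these
    points to the right. *)
Lemma step_drift p q : vertex p -> step p q -> X q <= X p -> X q <= 0 ->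
  q = w \/ (vertex q /\ forall r, In r P -> r = w \/ in_wedge u w sg q r -> X r <= X q).
Proof.
  intros Hp Hq L1 L2.
  destruct (step_coords p q Hq) as [_ [Hturn _]].
  destruct (ws_next _ _ _ _ _ _ _ _ _ _ Hq) as [E | [V [_ D]]]; [now left|right].
  split; [exact V|]. intros r Pr Wr. destruct (D r Pr Wr) as [D1 D2].
  pose proof (combination sg (lat sg b) (vsub q p) (vsub q u) (vsub r q) (lat_linear b sg)) as I.
  rewrite (lat_diff u b sg r q), (lat_diff u b sg q p) in I. fold (X r) (X q) (X p) in I.
  assert (T : turn sg (vsub q p) (vsub q u) = - turn sg (vsub p u) (vsub q u))
    by (unfold turn, cross, vsub; simpl; ring).
  rewrite (turn_origin u b sg sg_sq (dirz_unit n z)) in T. fold (X p) (H p) (X q) (H q) in T.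
  rewrite T in I. apply Rnot_lt_le; intro L. nra.
Qed.

(** * Summing along the chain *)

Lemma walk_induction (Q : pt -> Prop) :
  (forall p q, vertex p -> step p q -> (q <> w -> vertex q -> Q q) -> Q p) ->
  forall p, vertex p -> Q p.
Proof.
  intros Hstep p0 Hp0.
  apply (finite_real_induction (fun x => - H x) (fun x => vertex x -> Q x) P);
    [|apply (wv_in _ _ _ _ _ _ _ _ _ Hp0)|easy].
  clear p0 Hp0. intros p Pp Hind Hp.
  destruct (next_vertex P S u w b sg s c sg_sq (dirz_unit n z) HS Hnc Pu Pw Huw) with (p := p)
    as [q Hq]; try apply target_coords; auto.
  apply (Hstep p q Hp Hq). intros Nq V.
  apply Hind; auto.
  - apply (ws_in _ _ _ _ _ _ _ _ _ _ Hq).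
  - destruct (step_coords p q Hq) as [[Hup _] _]. lra.
Qed.

Lemma walk_left p : vertex p ->
  (X p <= 0 /\ forall r, In r P -> r = w \/ in_wedge u w sg p r -> X r <= X p) ->
  linked (theta_edge n P S) p w (K * (H w - H p) - (X w - X p)).
Proof.
  intro Hp. pattern p. apply walk_induction; [|exact Hp]. clear p Hp.
  intros p q Hp Hq IHq [L1 L2].
  destruct (step_cost p q Hp Hq) as [C1 [C2 _]].
  pose proof (ws_in _ _ _ _ _ _ _ _ _ _ Hq) as Pq.
  assert (Xq : X q <= X p).
  { apply L2; auto. destruct (ws_next _ _ _ _ _ _ _ _ _ _ Hq) as [E | [_ [W _]]]; auto. }
  assert (C : linked (theta_edge n P S) p q (K * (H q - H p) - (X q - X p))).
  { destruct (Rle_lt_or_eq_dec _ _ Xq) as [L|E]; [apply C2; lra|].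
    eapply linked_le; [apply C1|]; lra. }
  destruct (classic (q = w)) as [-> | Nq]; [exact C|].
  destruct (step_drift p q Hp Hq Xq) as [E | [V D]]; [lra|easy|].
  assert (C' : linked (theta_edge n P S) q w (K * (H w - H q) - (X w - X q)))
    by (apply IHq; auto; split; [lra|easy]).
  eapply linked_le; [apply (linked_trans _ _ _ _ _ _ C C')|]. lra.
Qed.

Lemma walk_right p : vertex p -> right_empty n P b sg u w ->
  linked (theta_edge n P S) p w (K * (H w - H p) + (X w - X p)).
Proof.
  intros Hp Hem. pattern p. apply walk_induction; [|exact Hp]. clear p Hp.
  intros p q Hp Hq IHq.
  destruct (step_cost p q Hp Hq) as [_ [_ C]]. specialize (C Hem).
  destruct (ws_next _ _ _ _ _ _ _ _ _ _ Hq) as [-> | [V _]]; [exact C|].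
  destruct (classic (q = w)) as [-> | Nq]; [exact C|].
  eapply linked_le; [apply (linked_trans _ _ _ _ _ _ C (IHq Nq V))|]. lra.
Qed.

(** The maximum is [|X w| - X p], so that adding the cost [K H v + X v] of the first edge [uv] gives
    [K H w + |X w|]. *)
Lemma walk_any p : vertex p ->
  linked (theta_edge n P S) p w (K * (H w - H p) + Rmax (X w - X p) (- X p - X w)).
Proof.
  intro Hp. pattern p. apply walk_induction; [|exact Hp]. clear p Hp.
  intros p q Hp Hq IHq.
  destruct (step_cost p q Hp Hq) as [C1 [C2 _]].
  destruct (vertex_coords p Hp) as [Hpos _].
  destruct (step_coords p q Hq) as [[Hup _] [Hturn _]].
  pose proof (Rmax_l (X w - X p) (- X p - X w)) as M1.
  pose proof (Rmax_r (X w - X p) (- X p - X w)) as M2.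
  destruct (Rle_lt_dec 0 (X q - X p)) as [L|L].
  - specialize (C1 L). destruct (classic (q = w)) as [-> | Nq].
    { eapply linked_le; [exact C1|]. lra. }
    destruct (ws_next _ _ _ _ _ _ _ _ _ _ Hq) as [E | [V _]]; [easy|].
    eapply linked_le; [apply (linked_trans _ _ _ _ _ _ C1 (IHq Nq V))|].
    assert (Rmax (X w - X q) (- X q - X w) + (X q - X p) <= Rmax (X w - X p) (- X p - X w)); [|lra].
    unfold Rmax at 1. destruct Rle_dec; lra.
  - specialize (C2 L).
    (* An edge to the left with [q] right of [up] has both ends left of the line through [u] along
       [b]. The rest then costs [X p - X w] in offsets, at most [- X p - X w]. *)
    assert (Xq : X q < 0).
    { apply Rnot_le_lt; intro L'. assert (0 <= X q * (H q - H p)) by nra.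
      assert (0 < (X p - X q) * H q) by (apply Rmult_lt_0_compat; lra). lra. }
    assert (Xp : X p < 0).
    { apply Rnot_le_lt; intro L'. assert (0 <= X p * H q) by nra.
      assert (0 < H p * - X q) by (apply Rmult_lt_0_compat; lra). lra. }
    destruct (step_drift p q Hp Hq) as [-> | [V D]]; [lra|lra| |].
    + eapply linked_le; [exact C2|]. lra.
    + assert (C' : linked (theta_edge n P S) q w (K * (H w - H q) - (X w - X q)))
        by (apply walk_left; auto; split; [lra|easy]).
      eapply linked_le; [apply (linked_trans _ _ _ _ _ _ C2 C')|]. lra.
Qed.

(** [Low] speaks of visible vertices only. But the lowest vertex [r0] of the wedge, if not above
    [v], is visible from [u] by [wedge_uncrossed] with the line through [r0] perpendicular to
    [b]. *)
Lemma first_vertex v : In v P -> in_sector n b (vsub v u) -> sees S u v ->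
  H v < H w -> 0 < turn sg (vsub w u) (vsub v u) ->
  (forall x, In x P -> is_constraint S u x -> in_sector n b (vsub x u) -> 
     ~ strictly_between u v x w) ->
  (forall r, In r P -> in_sector n b (vsub r u) -> sees S u r -> strictly_between u v r w ->
     H v <= H r) ->
  vertex v.
Proof.
  intros Pv Sv Vv Hvw Tv Free Low.
  assert (TO := turn_origin u b sg sg_sq (dirz_unit n z)).
  pose proof sc_facts as [Hs [Hc _]].
  destruct target_coords as [Hwl Hwr].
  pose proof (proj1 (sector_coords z sg _ sg_sq) Sv) as Cv.
  change (- (H v * s) < X v * c < H v * s) in Cv.
  assert (Hv : 0 < H v) by nra.
  assert (Bet : forall x, in_wedge u w sg v x -> in_sector n b (vsub x u) /\ strictly_between u v x w).
  { intros x [W1 W2]. split.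
    - apply (sector_coords z sg); [apply sg_sq|]. change (- (H x * s) < X x * c < H x * s).
      rewrite TO in W1, W2, Tv.
      fold (X v) (H v) (X x) (H x) (X w) (H w) in W1, W2, Tv.
      set (D := X w * H v - H w * X v) in *.
      assert (I1 : D * (X x * c + H x * s) = (X w * H x - H w * X x) * (X v * c + H v * s)
         + - (X v * H x - H v * X x) * (X w * c + H w * s)) by (unfold D; ring).
      assert (I2 : D * (H x * s - X x * c) = (X w * H x - H w * X x) * (H v * s - X v * c)
         + - (X v * H x - H v * X x) * (H w * s - X w * c)) by (unfold D; ring).
      assert (0 < (X w * H x - H w * X x) * (X v * c + H v * s)) by (apply Rmult_lt_0_compat; lra).
      assert (0 < - (X v * H x - H v * X x) * (X w * c + H w * s)) by (apply Rmult_lt_0_compat; lra).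
      assert (0 < (X w * H x - H w * X x) * (H v * s - X v * c)) by (apply Rmult_lt_0_compat; lra).
      assert (0 < - (X v * H x - H v * X x) * (H w * s - X w * c)) by (apply Rmult_lt_0_compat; lra).
      split; apply Rnot_le_lt; intro L; nra.
    - unfold strictly_between. rewrite (turn_anti sg (vsub w u)) in W2.
      pose proof sg_sq as Q.
      assert (0 < - turn sg (vsub v u) (vsub x u) * - turn sg (vsub x u) (vsub w u))
        by (apply Rmult_lt_0_compat; lra).
      unfold turn in *.
      replace (cross (vsub v u) (vsub x u) * cross (vsub x u) (vsub w u)) with
        (sg * sg * (cross (vsub v u) (vsub x u) * cross (vsub x u) (vsub w u))) by (rewrite Q; ring).
      lra. }
  assert (Fr : forall x, is_constraint S u x -> turn sg (vsub v u) (vsub x u) < 0 ->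
     turn sg (vsub w u) (vsub x u) <= 0).
  { intros x Cx W1. apply Rnot_lt_le; intro W2. destruct (Bet x (conj W1 W2)) as [B1 B2].
    apply (Free x); auto. destruct HS as [HS1 _]. destruct Cx as [Cx|Cx]; now apply HS1 in Cx. }
  assert (Uv : uncrossed S u v) by now apply (sees_uncrossed P).
  constructor; auto; try apply Cv.
  intros r Pr Wr. apply Rnot_le_lt; intro L. change (H r <= H v) in L.
  destruct (argmin_exists H (fun x => in_wedge u w sg v x) P) as [r0 [P0 [W0 L0]]]; [now exists r|].
  destruct (Bet r0 W0) as [S0 B0].
  pose proof (proj1 (sector_coords z sg _ sg_sq) S0) as C0.
  change (- (H r0 * s) < X r0 * c < H r0 * s) in C0.
  assert (H0 : 0 < H r0) by nra.
  assert (Hrv : H r0 <= H v) by (specialize (L0 r Pr Wr); lra).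
  assert (Hu : H u = 0) by apply (origin_coords u b sg).
  assert (Af : affine (fun x => H x - H r0)) by apply affine_dot.
  assert (Nv : r0 <> v) by (intros ->; destruct W0 as [W _]; unfold turn, cross in W; lra).
  assert (V0 : uncrossed S u r0).
  { apply (wedge_uncrossed sg P S u v w (fun x => H x - H r0)); auto using sg_sq; try lra.
    - intros x Px W1 W2. assert (H r0 <= H x) by (apply L0; [easy|now split]). lra.
    - intros t Ht.
      rewrite (affine_turn sg (vsub v u) u t u r0), (affine_turn sg (vsub w u) u t u r0), (Af t u r0).
      cbv beta. destruct W0 as [W1 W2].
      assert (Z : forall a, turn sg a (vsub u u) = 0)
        by (intro; unfold turn, cross, vsub; simpl; ring).
      rewrite !Z, Hu. split; [nra|]. split; nra.
    - intros x y Hx. destruct (properly_intersect_lerp _ _ _ _ Hx) as [t [t' [Ht [Ht' E]]]].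
      assert (A1 := Af t u r0). assert (A2 := Af t' x y). cbv beta in A1, A2.
      rewrite E, A2, Hu in A1.
      destruct (Rlt_le_dec (H x - H r0) 0); [now left|right].
      apply Rnot_le_lt; intro L'. nra. }
  assert (H v <= H r0) by (apply Low; auto; right; exact V0).
  apply (Hgp v r0 z Pv P0 (not_eq_sym Nv)).
  change (dot (vsub r0 v) b = 0). destruct (edge_coords v r0) as [_ ->]. lra.
Qed.
End Step.

(** The triangle inequality round the left upper corner of the canonical triangle: [h / c] to the
    corner, then [h s / c + x] to the vertex. *)
Lemma direct_cost x h : - (h * s) < x * c < h * s -> sqrt (x * x + h * h) <= K * h + x.
Proof.
  intros Hx. destruct sc_facts as [Hs [Hc [Hsc [_ HK]]]].
  assert (Hh : 0 < h) by nra.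
  assert (EK : c * K = 1 + s) by (unfold K; field; lra).
  assert (E : c * (K * h + x) = h * (1 + s) + x * c) by (rewrite <- EK; ring).
  assert (Hpos : 0 <= K * h + x).
  { apply Rmult_le_reg_l with c; [easy|]. rewrite E. nra. }
  rewrite <- (sqrt_square (K * h + x)) by easy. apply sqrt_le_1_alt.
  apply Rmult_le_reg_l with (c * c); [nra|].
  replace (c * c * ((K * h + x) * (K * h + x))) with ((c * (K * h + x)) * (c * (K * h + x))) by ring.
  rewrite E.
  assert (0 <= h * (1 + s) * (x * c + h * s)) by (apply Rmult_le_pos; [nra|lra]).
  assert (c * c * (h * h) = h * h * (1 - s) * (1 + s)) by (replace (c * c) with (1 - s * s) by lra; ring).
  nra.
Qed.

Lemma theta_edge_cost z sg u w : sg = 1 \/ sg = -1 -> theta_edge n P S u w ->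
  in_sector n (dirz n z) (vsub w u) ->
  linked (theta_edge n P S) u w (K * dot (vsub w u) (dirz n z) + lat sg (dirz n z) (vsub w u)).
Proof.
  intros Hsg He Hw. apply sign_sq in Hsg. apply linked_edge; [easy|].
  rewrite pdist_sym. unfold pdist. rewrite (norm_coords sg (dirz n z)) by auto using dirz_unit.
  apply direct_cost. now apply sector_coords.
Qed.

Lemma spans_all u w z : In u P -> In w P -> spans n P S K (dirz n z) u w.
Proof.
  assert (Hn : (2 <= n)%nat) by (unfold n; lia).
  (* Pairs of vertices together with one of the [n] bisectors form a finite list, as the induction
     on heights requires. *)
  assert (All : forall x, In x (list_prod P (list_prod P (map (bisector n) (seq 0 n)))) ->
    spans n P S K (snd (snd x)) (fst x) (fst (snd x))).
  2: { intros Pu Pw. destruct (dirz_bisector n z) as [i [Hi ->]]; [lia|].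
       apply (All (u, (w, bisector n i))).
       apply in_prod; [easy|]. apply in_prod; [easy|]. apply in_map, in_seq. lia. }
  clear u w z.
  apply (finite_real_induction (fun x => dot (vsub (fst (snd x)) (fst x)) (snd (snd x)))).
  intros [u [w b]] Hx Hind. simpl in *.
  apply in_prod_iff in Hx. destruct Hx as [Pu Hx].
  apply in_prod_iff in Hx. destruct Hx as [Pw Hx].
  apply in_map_iff in Hx. destruct Hx as [i [<- Hi]]. apply in_seq in Hi.
  rewrite bisector_dirz in *. set (z := Z.of_nat i) in *.
  assert (IH : forall x y z', In x P -> In y P ->
    dot (vsub y x) (dirz n z') < dot (vsub w u) (dirz n z) -> spans n P S K (dirz n z') x y).
  { intros x y z' Px Py L. destruct (dirz_bisector n z') as [j [Hj E]]; [lia|]. rewrite E in *.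
    apply (Hind (x, (y, bisector n j))); [|easy].
    apply in_prod; [easy|]. apply in_prod; [easy|]. apply in_map, in_seq. lia. }
  clear Hind. intros Vuw Suw.
  assert (Cone : forall r, in_cone n u i r <-> in_sector n (dirz n z) (vsub r u)).
  { intro r. unfold in_cone, in_sector. rewrite bisector_dirz. fold z. 
    split; [now intros [_ H]|]. intro H. split; [lia|exact H]. }
  destruct (first_visible_in_subcone n P S u w i Hn Hnc Pu Pw Vuw) as [v [Pv [Sv [Vv [Ev Fv]]]]];
    [now apply Cone|].
  apply Cone in Sv.
  destruct (classic (v = w)) as [-> | Nvw].
  { split.
    - destruct (Rle_lt_dec 0 (lat 1 (dirz n z) (vsub w u))) as [L|L].
      + rewrite (Rabs_lat 1), Rabs_right by (auto; lra). apply theta_edge_cost; auto.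
      + rewrite (Rabs_lat 1), Rabs_left by auto.
        replace (- lat 1 (dirz n z) (vsub w u)) with (lat (-1) (dirz n z) (vsub w u)) by (unfold lat; ring).
        apply theta_edge_cost; auto.
    - intros sg Hsg _. now apply theta_edge_cost. }
  destruct Fv as [E | [Lv [Free Low]]]; [easy|].
  unfold proj in Lv, Low. rewrite bisector_dirz in Lv, Low. fold z in Lv, Low.
  assert (Huw : uncrossed S u w) by now apply (sees_uncrossed P).
  assert (Pos : forall r, in_sector n (dirz n z) (vsub r u) -> 0 < dot (vsub r u) (dirz n z)).
  { intros r Hr. unfold z. rewrite <- bisector_dirz. apply cone_dot_pos; auto. now apply Cone. }
  assert (Nu : forall r, in_sector n (dirz n z) (vsub r u) -> u <> r).
  { intros r Hr <-. apply Pos in Hr. unfold dot, vsub in Hr; simpl in Hr. lra. }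
  assert (Cr : cross (vsub w u) (vsub v u) <> 0).
  { apply Hnc; auto using not_eq_sym. }
  assert (Lv' : dot (vsub v u) (dirz n z) < dot (vsub w u) (dirz n z)).
  { assert (dot (vsub w v) (dirz n z) <> 0) by (apply Hgp; auto).
    replace (dot (vsub w v) (dirz n z)) with (dot (vsub w u) (dirz n z) - dot (vsub v u) (dirz n z)) in H
      by (unfold dot, vsub; simpl; ring). lra. }
  assert (He : exists e, (e = 1 \/ e = -1)%Z /\ 0 < turn (IZR e) (vsub w u) (vsub v u)).
  { unfold turn. destruct (Rlt_le_dec 0 (cross (vsub w u) (vsub v u)));
      [exists 1%Z|exists (-1)%Z]; split; auto; simpl; lra. }
  destruct He as [e [He Te]].
  assert (Vx : walk_vertex P S u w (dirz n z) (IZR e) s c v).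
  { apply first_vertex; auto.
    - intros x Px Cx Sx. apply Free; auto. now apply Cone.
    - intros r Pr Sr Vr Br. apply Low; auto. now apply Cone. }
  assert (First := theta_edge_cost z (IZR e) u v (sign_IZR e He) Ev Sv).
  split.
  - assert (A := walk_any u w z e He Pu Pw Huw Suw IH v Vx).
    eapply linked_le; [apply (linked_trans _ _ _ _ _ _ First A)|].
    rewrite (Rabs_lat (IZR e)) by (apply sign_IZR, He).
    pose proof (Rle_abs (lat (IZR e) (dirz n z) (vsub w u))) as A1.
    pose proof (Rle_abs (- lat (IZR e) (dirz n z) (vsub w u))) as A2. rewrite Rabs_Ropp in A2.
    unfold Rmax. destruct Rle_dec; lra.
  - intros sg Hsg Hem.
    assert (Esg : sg = IZR e \/ sg = - IZR e).
    { destruct (sign_IZR e He) as [-> | ->]; destruct Hsg as [-> | ->]; (left; lra) || (right; lra). }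
    destruct Esg as [-> | ->].
    + assert (A := walk_right u w z e He Pu Pw Huw Suw IH v Vx Hem).
      eapply linked_le; [apply (linked_trans _ _ _ _ _ _ First A)|]. lra.
    (* Here [v] itself would lie in the part assumed empty. *)
    + specialize (Hem v Pv Sv Lv'). rewrite turn_neg in Hem. lra.
Qed.
End Induction.

(** * From height and offset to length and angle *)

Theorem theorem1 (k : nat) (P : list pt) (S : list (pt * pt)) (u w : pt) (i : nat) :
  (1 <= k)%nat ->
  NoDup P ->
  general_position (4 * k + 2) P ->
  constraints_ok P S ->
  In u P -> In w P ->
  sees S u w ->
  in_cone (4 * k + 2) u i w ->
  let th := cone_angle (4 * k + 2) in
  let m := canon_midpoint (4 * k + 2) u i w in
  let alpha := unsigned_angle (vsub w u) (vsub m u) in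
  exists l : list pt,
    graph_path (4 * k + 2) P S u w l /\
    path_length l <=
      ((1 + sin (th / 2)) / cos (th / 2) * cos alpha + sin alpha) * pdist u w.
Proof.
  intros Hk _ Hgp HS Pu Pw Vuw Cw th m alpha.
  set (n := (4 * k + 2)%nat) in *.
  assert (Hnc : noncollinear P).
  { intros p q r Pp Pq Pr N1 N2 N3. apply (proj2 (proj2 (Hgp p q Pp Pq N1))); auto. }
  assert (Hgp' : forall p q z, In p P -> In q P -> p <> q -> dot (vsub q p) (dirz n z) <> 0).
  { intros p q z Pp Pq N. destruct (dirz_bisector n z) as [j [Hj ->]]; [unfold n; lia|].
    now apply (proj1 (proj2 (Hgp p q Pp Pq N))). }
  assert (Hpos : 0 < dot (vsub w u) (bisector n i)) by (apply cone_dot_pos; [unfold n; lia|easy]).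
  destruct (sin_cos_d k Hk) as [_ [Hc _]]. fold n th in Hc.
  destruct (spans_all k P S Hk HS Hnc Hgp' u w (Z.of_nat i) Pu Pw Vuw) as [L _].
  { fold n. rewrite <- bisector_dirz. apply Cw. }
  fold n th in L. rewrite <- bisector_dirz in L.
  set (b := bisector n i) in *. set (h := dot (vsub w u) b) in *.
  set (x := dot (vsub w u) (perp b)) in *.
  apply linked_path in L. destruct L as [l [Hh [Hl [Hch Hlen]]]].
  exists l. split; [split; [easy|split; [apply Hl|easy]]|].
  apply (Rle_trans _ _ _ Hlen). right.
  (* The midpoint is the foot of the height from [u], so [cos alpha = h / D] and
     [sin alpha = |x| / D], which makes the claimed bound equal to [K h + |x|]. *)
  assert (Em : vsub m u = (h * fst b, h * snd b)).
  { unfold m, canon_midpoint, canon_corner, vsub. cbn [fst snd]. fold th.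
    change (proj n i u w) with h. unfold b, bisector. cbn [fst snd]. fold th.
    replace (INR i * th + -1 * (th / 2)) with (INR i * th - th / 2) by ring.
    rewrite Rmult_1_l, sin_plus, sin_minus, cos_plus, cos_minus.
    f_equal; field; lra. }
  assert (Eb : dot b b = 1) by apply bisector_unit.
  assert (Nm : norm (vsub m u) = h).
  { rewrite Em. unfold norm. replace (dot _ _) with (h * h * dot b b) by (unfold dot; simpl; ring).
    rewrite Eb, Rmult_1_r. apply sqrt_square; lra. }
  assert (Dm : dot (vsub w u) (vsub m u) = h * h).
  { rewrite Em. unfold h at 3. unfold dot; simpl; ring. }
  set (D := pdist u w).
  assert (HD : norm (vsub w u) = D) by (unfold D; rewrite pdist_sym; easy).
  assert (D2 : D * D = x * x + h * h).
  { rewrite <- HD, (norm_coords 1 b) by lra.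
    rewrite sqrt_sqrt by nra. unfold lat. fold x h. ring. }
  assert (D0 : 0 < D).
  { assert (0 <= D) by (rewrite <- HD; apply sqrt_pos). nra. }
  assert (Ea : alpha = acos (h / D)).
  { unfold alpha, unsigned_angle. rewrite Dm, Nm, HD. f_equal. field. lra. }
  assert (Hr : -1 <= h / D <= 1).
  { assert (0 < h / D) by (apply Rdiv_lt_0_compat; lra). split; [lra|].
    apply Rmult_le_reg_r with D; [easy|]. unfold Rdiv. rewrite Rmult_assoc, Rinv_l by lra. nra. }
  rewrite Ea, cos_acos, sin_acos by easy.
  replace (1 - (h / D)²) with ((x / D) * (x / D)).
  2: { unfold Rsqr. apply Rmult_eq_reg_r with (D * D); [|nra].
       field_simplify; [|lra|lra]. simpl. lra. }
  rewrite <- (Rsqr_def (x / D)), sqrt_Rsqr_abs.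
  replace (Rabs (x / D)) with (Rabs x / D); [field; lra|].
  unfold Rdiv. rewrite Rabs_mult, (Rabs_right (/ D)); [easy|].
  left. now apply Rinv_0_lt_compat.
Qed.
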